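(* Consider the collaborative pure exploration in kernel bandit problem with $V$ agents and $n$ arms per agent, let $\delta\in(0,1)$, and suppose that the regularization parameter $\xi>0$ satisfies $$\sqrt{\xi}\,\max_{\tilde x_i,\tilde x_j\in\tilde{\mathcal X}_v,\ v\in[V]}\|\phi(\tilde x_i)-\phi(\tilde x_j)\|_{A(\xi,\lambda_1^* )^{-1}}\ \le\ \frac{\Delta_{\min}}{32(1+\varepsilon)\|\theta^*\|}.$$ Then, with probability at least $1-\delta$, the per-agent sample complexity $S$ (the average number of samples used by each agent) of the algorithm CoKernelFC can be bounded by each of the following: (a) $S=\tilde O\left(\dfrac{\Upsilon}{\Delta_{\min}^2V}\right)$; (b) $S=\tilde O\left(\dfrac{d_{\mathrm{eff}}}{\Delta_{\min}^2V}\right)$; (c) $S=\tilde O\left(\dfrac{\mathrm{rank}(K_{\mathcal Z})\cdot\mathrm{rank}(K_{\mathcal X,\lambda^*})}{\Delta_{\min}^2V}\right)$, where $\tilde O(\cdot)$ omits the additive rounding cost term $\tilde d(\xi,\lambda_1^* )\log(\Delta_{\min}^{-1})/V$ and logarithmic factors.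
   Context: **Problem.** There are $V$ agents, $[V]=\{1,\dots,V\}$. Agent $v$ has $n$ arms $\mathcal X_v=\{x_{v,1},\dots,x_{v,n}\}$ (vectors in a Euclidean space) and a task feature $z_v$ in a set $\mathcal Z$. Put $\tilde x_{v,i}=(z_v,x_{v,i})$, $\tilde{\mathcal X}_v=\{\tilde x_{v,1},\dots,\tilde x_{v,n}\}$, and let $\tilde{\mathcal X}=\bigcup_v\tilde{\mathcal X}_v$ be the family of all $nV$ task-arm pairs, also listed with a single index as $\tilde x_1,\dots,\tilde x_{nV}$ (with arm part $x_i$). With $\mathcal X=\bigcup_v\mathcal X_v$, there is a kernel on $\mathcal Z\times\mathcal X$ of product form $k((z,x),(z',x'))=k_{\mathcal Z}(z,z')\,k_{\mathcal X}(x,x')$ with RKHS $\mathcal H$ (possibly infinite dimensional), a feature map $\phi$ into $\mathcal H$ with $k(\tilde x,\tilde x')=\phi(\tilde x)^\top\phi(\tilde x')$, and an unknown $\theta^*\in\mathcal H$ such that the expected reward of $\tilde x$ is $F(\tilde x)=\phi(\tilde x)^\top\theta^*$. Here $h^\top h'$ is the inner product of $\mathcal H$, $\|h\|=\sqrt{h^\top h}$, $\|h\|_{M^{-1}}=\sqrt{h^\top M^{-1}h}$, and $hh^\top$ is the rank-one operator $g\mapsto (h^\top g)h$. Agent $v$ can only sample arms of $\tilde{\mathcal X}_v$; each sample of $\tilde x$ returns $F(\tilde x)+\eta$ with $\eta$ zero-mean and 1-sub-Gaussian, independent across samples and agents. The best arm $\tilde x_{v,*}=\arg\max_{\tilde x\in\tilde{\mathcal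 X}_v}F(\tilde x)$ is unique for each $v$. In a communication round, each agent broadcasts a message to, and receives messages from, all other agents. **Quantities.** $\triangle_{\tilde{\mathcal X}}$ is the set of probability distributions on $\tilde{\mathcal X}$. For $\lambda\in\triangle_{\tilde{\mathcal X}}$: $A(\xi,\lambda)=\xi I+\sum_{\tilde x\in\tilde{\mathcal X}}\lambda_{\tilde x}\phi(\tilde x)\phi(\tilde x)^\top$; $\tilde d(\xi,\lambda)$ is the number of eigenvalues of $\sum_{\tilde x}\lambda_{\tilde x}\phi(\tilde x)\phi(\tilde x)^\top$ greater than $\xi$. $\Delta_{\min}=\min_{\tilde x\in\tilde{\mathcal X}_v\setminus\{\tilde x_{v,*}\},\,v\in[V]}(F(\tilde x_{v,*})-F(\tilde x))$. With $\lambda_i$ the weight of $\tilde x_i$, let $K_\lambda=[\sqrt{\lambda_i\lambda_j}\,k(\tilde x_i,\tilde x_j)]_{i,j\in[nV]}$. The maximum information gain is $\Upsilon=\max_{\lambda\in\triangle_{\tilde{\mathcal X}}}\log\det(I+\xi^{-1}K_\lambda)$, and $\lambda^*$ is a maximizer. If $\alpha_1\ge\dots\ge\alpha_{nV}$ are the eigenvalues of $K_{\lambda^*}$, the effective dimension is $d_{\mathrm{eff}}=\min\{j\in[nV]:\ j\xi\log(nV)\ge\sum_{i=j+1}^{nV}\alpha_i\}$. Also $K_{\mathcal Z}=[k_{\mathcal Z}(z_v,z_{v'})]_{v,v'\in[V]}$ and $K_{\mathcal X,\lambda^*}=[\sqrt{\lambda^*_i\lambda^*_j}\,k_{\mathcal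 X}(x_i,x_j)]_{i,j\in[nV]}$. The omitted logarithmic factors are logarithmic in $n$, $V$, $1/\delta$, $1/\Delta_{\min}$ and $\xi^{-1}\mathrm{Trace}(K_{\lambda^*})$. **Rounding procedure ROUND.** Given $\xi$, $\lambda\in\triangle_{\tilde{\mathcal X}}$, $\varepsilon$ and an integer $N\ge\tau(\xi,\lambda,\varepsilon)$, where $\tau(\xi,\lambda,\varepsilon)=O(\tilde d(\xi,\lambda)/\varepsilon^2)$ is the number of samples ROUND needs, $\mathrm{ROUND}(\xi,\lambda,N,\varepsilon)$ returns a sequence $(\tilde s_1,\dots,\tilde s_N)\in\tilde{\mathcal X}^N$ such that $$\max_{\tilde x_i,\tilde x_j\in\tilde{\mathcal X}_v,\,v\in[V]}\|\phi(\tilde x_i)-\phi(\tilde x_j)\|^2_{(N\xi I+\sum_{l=1}^N\phi(\tilde s_l)\phi(\tilde s_l)^\top)^{-1}}\le 2(1+\varepsilon)\max_{\tilde x_i,\tilde x_j\in\tilde{\mathcal X}_v,\,v\in[V]}\|\phi(\tilde x_i)-\phi(\tilde x_j)\|^2_{(N\xi I+\sum_{\tilde x\in\tilde{\mathcal X}}N\lambda_{\tilde x}\phi(\tilde x)\phi(\tilde x)^\top)^{-1}}.$$ **Algorithm CoKernelFC** (inputs $\delta$, $\tilde{\mathcal X}$, $k$, $\xi$, ROUND; $\varepsilon=\frac1{10}$; $\delta_r=\delta/(2r^2)$). Set $\mathcal B_v^{(1)}=\tilde{\mathcal X}_v$ for all $v$. In round $r=1,2,\dots$: 1. Let $\lambda_r^*$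 and $\rho_r^*$ be the optimal solution and the optimal value of $\min_{\lambda\in\triangle_{\tilde{\mathcal X}}}\max_{\tilde x_i,\tilde x_j\in\mathcal B_v^{(r)},\,v\in[V]}\|\phi(\tilde x_i)-\phi(\tilde x_j)\|^2_{A(\xi,\lambda)^{-1}}$. 2. $N^{(r)}=\max\{\lceil 32(2^r)^2(1+\varepsilon)^2\rho_r^*\log(2n^2V/\delta_r)\rceil,\ \tau(\xi,\lambda_r^*,\varepsilon)\}$. 3. Compute $(\tilde s_1,\dots,\tilde s_{N^{(r)}})=\mathrm{ROUND}(\xi,\lambda_r^*,N^{(r)},\varepsilon)$; each agent $v$ samples the arms of this sequence that belong to $\tilde{\mathcal X}_v$. Let $N_i^{(r)}$ and $\bar y_i^{(r)}$ be the number of samples and the average outcome on $\tilde x_i$ in round $r$. 4. In one communication round, each agent broadcasts the pairs (number of samples, average outcome) of her $n$ arms. 5. With $k_r(\tilde x)=[\sqrt{N_i^{(r)}}k(\tilde x,\tilde x_i)]_{i\in[nV]}$, $K^{(r)}=[\sqrt{N_i^{(r)}N_j^{(r)}}k(\tilde x_i,\tilde x_j)]_{i,j\in[nV]}$, $\bar y^{(r)}=[\sqrt{N_i^{(r)}}\bar y_i^{(r)}]_{i\in[nV]}$, set $\hat\Delta_r(\tilde x,\tilde x')=(k_r(\tilde x)-k_r(\tilde x'))^\top(K^{(r)}+N^{(r)}\xi I)^{-1}\bar y^{(r)}$. 6. For all $v$: $\mathcal B_v^{(r+1)}=\mathcal B_v^{(r)}\setminus\{\tilde x\in\mathcal B_v^{(r)}:\exists\,\tilde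 x'\in\mathcal B_v^{(r)},\ \hat\Delta_r(\tilde x',\tilde x)\ge 2^{-r}\}$. 7. If $|\mathcal B_v^{(r+1)}|=1$ for all $v$, stop and return $\mathcal B_1^{(r+1)},\dots,\mathcal B_V^{(r+1)}$. In particular $\lambda_1^*$ is the optimal allocation for the full sets $\tilde{\mathcal X}_v$.
   Formalization: ROUND's inequality is also assumed with the candidate sets B_v in place of X~_v when called on their optimal design (otherwise the algorithm may never stop), and the constants in the O~ may depend on an upper bound for Delta_min. *)

(* Defs.v *)
From mathcomp Require Import all_boot all_order all_algebra.
From mathcomp Require Import all_classical all_reals all_analysis.

Set Implicit Arguments.
Unset Strict Implicit.
Unset Printing Implicit Defensive.

Import Order.TTheory GRing.Theory Num.Theory.
Import numFieldNormedType.Exports.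

Local Open Scope classical_set_scope.
Local Open Scope ring_scope.

(* The pair [(v, i)] stands for the i-th task-arm pair of agent v; the family
   of all n * V pairs is indexed, so pairs with equal features stay distinct. *)
Notation arm V n := ('I_V * 'I_n)%type (only parsing).

(* One candidate set of arms per agent. *)
Notation arm_sets V n := {ffun 'I_V -> {set 'I_n}} (only parsing).

Definition all_arms (V n : nat) : arm_sets V n := [ffun _ => [set: 'I_n]%SET].

Section Probability.
Context {d : measure_display} {Om : measurableType d} {R : realType}.
Variable P : probability Om R.

Definition mutually_independent (J : eqType) (X : J -> {RV P >-> R}) : Prop :=
  forall (s : seq J) (E : J -> set R), uniq s -> (forall j, measurable (E j)) ->
    P (\big[setI/setT]_(j <- s) (X j @^-1` E j)) =
    (\prod_(j <- s) P (X j @^-1` E j))%E.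

Definition one_subgaussian (X : {RV P >-> R}) : Prop :=
  forall t : R, ('M_P X t <= (expR (t ^+ 2 / 2))%:E)%E.

End Probability.

Section Kernels.
Context {R : realType}.

Definition product_kernel (Z X : Type) (kZ : Z -> Z -> R) (kX : X -> X -> R) :
  Z * X -> Z * X -> R := fun s t => kZ s.1 t.1 * kX s.2 t.2.

(* [H] is a space of functions on [D]: [ev h] is the function represented by
   [h], two elements with the same values on [D] are equal, and k(., t) is an
   element of the space that reproduces evaluation at [t]. *)
Definition is_rkhs (T : Type) (D : set T) (k : T -> T -> R) (H : lmodType R)
    (dot : {dot H for idfun}) (ev : H -> T -> R) : Prop :=
  (forall h h', (forall t, D t -> ev h t = ev h' t) -> h = h') /\
  (forall t, D t -> exists2 kt : H,
     forall s, D s -> ev kt s = k s t & forall h, ev h t = dot h kt).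

End Kernels.

Section Operators.
Context {R : realType} {H : lmodType R}.
Variable dot : {dot H for idfun}.

Definition rank1 (h : H) : H -> H := fun g => dot h g *: h.

(* The inverse of a bijective operator; 0 off the range otherwise. *)
Definition op_inv (M : H -> H) : H -> H := fun h => xget 0 [set g | M g = h].

Definition inv_norm (M : H -> H) (h : H) : R := Num.sqrt (dot h (op_inv M h)).

Context {V n : nat}.
Variable feat : arm V n -> H.

Definition simplex : set {ffun arm V n -> R} :=
  [set l | (forall a, 0 <= l a) /\ \sum_a l a = 1].

Definition cov_op (l : {ffun arm V n -> R}) : H -> H :=
  fun g => \sum_a l a *: rank1 (feat a) g.

Definition reg_op (xi : R) (l : {ffun arm V n -> R}) : H -> H :=
  fun g => xi *: g + cov_op l g.

(* The number of eigenvalues of the self-adjoint operator [cov_op l] that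
   exceed [xi], with multiplicity, i.e. the size of the largest orthonormal
   family of eigenvectors for such eigenvalues. The operator has rank at most
   #|arm V n|, hence the range of the maximum. *)
Definition dtilde (xi : R) (l : {ffun arm V n -> R}) : nat :=
  \max_(m < #|{: arm V n}|.+1 |
    `[< exists (h : 'I_m -> H) (mu : 'I_m -> R),
          (forall i j, dot (h i) (h j) = (i == j)%:R) /\
          (forall i, cov_op l (h i) = mu i *: h i /\ xi < mu i) >]) m.

(* Maximum over pairs of candidate arms of a same agent; the base value 0 is
   harmless since it is only used for nonnegative [f]. *)
Definition max_pairs (B : arm_sets V n) (f : arm V n -> arm V n -> R) : R :=
  \big[Num.max/0]_(v < V) \big[Num.max/0]_(i in B v)
    \big[Num.max/0]_(j in B v) f (v, i) (v, j).

Definition width (B : arm_sets V n) (M : H -> H) : R :=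
  max_pairs B (fun a b => inv_norm M (feat a - feat b)).

Definition sq_width (B : arm_sets V n) (M : H -> H) : R :=
  max_pairs B (fun a b => inv_norm M (feat a - feat b) ^+ 2).

Definition optimal_design (xi : R) (B : arm_sets V n)
    (l : {ffun arm V n -> R}) : Prop :=
  simplex l /\
  forall l', simplex l' -> sq_width B (reg_op xi l) <= sq_width B (reg_op xi l').

Definition sampled_op (xi : R) (N : nat) (s : N.-tuple (arm V n)) : H -> H :=
  fun g => (N%:R * xi) *: g + \sum_(l < N) rank1 (feat (tnth s l)) g.

Definition planned_op (xi : R) (N : nat) (l : {ffun arm V n -> R}) : H -> H :=
  fun g => (N%:R * xi) *: g + \sum_a (N%:R * l a) *: rank1 (feat a) g.

Definition round_guarantee (xi eps : R) (B : arm_sets V n)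
    (l : {ffun arm V n -> R}) (N : nat) (s : N.-tuple (arm V n)) : Prop :=
  sq_width B (sampled_op xi s) <=
  2 * (1 + eps) * sq_width B (planned_op xi N l).

End Operators.

Section Gram.
Context {R : realType} {V n : nat}.

(* [enum_val] lists the n * V arms with a single index. *)
Definition weighted_gram (g : arm V n -> arm V n -> R) (w : arm V n -> R) :
    'M[R]_#|{: arm V n}| :=
  \matrix_(i, j) (Num.sqrt (w (enum_val i) * w (enum_val j))
                  * g (enum_val i) (enum_val j)).

Definition info_gain (k : arm V n -> arm V n -> R) (xi : R)
    (l : {ffun arm V n -> R}) : R :=
  ln (\det (1%:M + xi^-1 *: weighted_gram k l)).

Definition max_info_gain (k : arm V n -> arm V n -> R) (xi : R) : R :=
  sup [set info_gain k xi l | l in simplex].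

(* Eigenvalues with (algebraic) multiplicity, in nonincreasing order. *)
Definition is_spectrum (m : nat) (K : 'M[R]_m) (alpha : seq R) : Prop :=
  sorted (fun a b => b <= a) alpha /\
  char_poly K = \prod_(a <- alpha) ('X - a%:P).

Definition min_gap (F : arm V n -> R) (best : 'I_V -> 'I_n) : R :=
  inf [set g | exists v i, i != best v /\ g = F (v, best v) - F (v, i)].

End Gram.

(* The sequence is indexed from 0, so its items from position j on are
   alpha_(j+1), alpha_(j+2), and so on. The index j = n * V is always
   admissible, hence the base value. *)
Definition effective_dim (R : realType) (V n : nat) (xi : R) (alpha : seq R) : nat :=
  \big[minn/(n * V)%N]_(1 <= j < (n * V).+1 |
     \sum_(j <= i < n * V) alpha`_i <= j%:R * xi * ln (n * V)%:R) j.

(* A linear combination of the logarithms of the parameters, used to express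
   omitted logarithmic factors as powers of it; [tr] is the trace of the Gram
   matrix. *)
Definition log_factor (R : realType) (V n : nat) (xi delta gap tr : R) : R :=
  1 + ln n%:R + ln V%:R + ln delta^-1 + ln (1 + gap^-1) + ln (1 + tr / xi).

Section CoKernelFC.
Context {R : realType} {H : lmodType R} {V n : nat} {Om : Type}.
Variable dot : {dot H for idfun}.
Variable feat : arm V n -> H.
Variable k : arm V n -> arm V n -> R.
Variable F : arm V n -> R.
(* [eta r a j] is the noise of the j-th sample of arm [a] in round [r]. *)
Variable eta : nat -> arm V n -> nat -> Om -> R.
Variables xi delta eps : R.
(* The solver of the design problem. *)
Variable lam : arm_sets V n -> {ffun arm V n -> R}.
Variable tau : R -> {ffun arm V n -> R} -> R -> nat.
Variable ROUND : R -> {ffun arm V n -> R} ->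
  forall N : nat, R -> N.-tuple (arm V n).

Definition delta_ (r : nat) : R := delta / (2 * r%:R ^+ 2).

Definition rho (B : arm_sets V n) : R :=
  sq_width dot feat B (reg_op dot feat xi (lam B)).

Definition budget (r : nat) (B : arm_sets V n) : nat :=
  maxn `|Num.ceil (32 * (2 ^+ r) ^+ 2 * (1 + eps) ^+ 2 * rho B
                   * ln (2 * n%:R ^+ 2 * V%:R / delta_ r))|%N
       (tau xi (lam B) eps).

Definition allocation (r : nat) (B : arm_sets V n) :
    (budget r B).-tuple (arm V n) :=
  ROUND xi (lam B) (budget r B) eps.

Definition pulls (r : nat) (B : arm_sets V n) (a : arm V n) : nat :=
  count_mem a (allocation r B).

Definition mean_outcome (r : nat) (B : arm_sets V n) (w : Om) (a : arm V n) : R :=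
  (\sum_(j < pulls r B a) (F a + eta r a j w)) / (pulls r B a)%:R.

Definition kernel_col (r : nat) (B : arm_sets V n) (a : arm V n) :
    'cV[R]_#|{: arm V n}| :=
  \col_i (Num.sqrt (pulls r B (enum_val i))%:R * k a (enum_val i)).

Definition outcome_col (r : nat) (B : arm_sets V n) (w : Om) :
    'cV[R]_#|{: arm V n}| :=
  \col_i (Num.sqrt (pulls r B (enum_val i))%:R * mean_outcome r B w (enum_val i)).

Definition gap_estimate (r : nat) (B : arm_sets V n) (w : Om)
    (a b : arm V n) : R :=
  ((kernel_col r B a - kernel_col r B b)^T
   *m invmx (weighted_gram k (fun c => (pulls r B c)%:R)
             + ((budget r B)%:R * xi)%:M)
   *m outcome_col r B w) ord0 ord0.

Definition eliminate (r : nat) (B : arm_sets V n) (w : Om) : arm_sets V n :=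
  [ffun v => B v :\: [set i in B v |
     [exists i' in B v, 2 ^- r <= gap_estimate r B w (v, i') (v, i)]]]%SET.

(* The candidate sets at the start of round r = 1, 2, 3 ...; the value at 0 is
   a dummy. The recursion ignores the stopping rule, which is in [stops_at]. *)
Fixpoint candidates (r : nat) (w : Om) : arm_sets V n :=
  match r with
  | 0 => all_arms V n
  | r'.+1 => if r' == 0%N then all_arms V n
             else eliminate r' (candidates r' w) w
  end.

Definition settled (B : arm_sets V n) : Prop := forall v, #|B v| = 1%N.

Definition stops_at (w : Om) (r : nat) : Prop :=
  [/\ (1 <= r)%N, settled (candidates r.+1 w) &
      forall r', (1 <= r' < r)%N -> ~ settled (candidates r'.+1 w)].

(* Equal to +oo (the infimum of the empty set) if the algorithm never stops. *)
Definition sample_complexity (w : Om) : \bar R :=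
  ereal_inf [set ((\sum_(1 <= r' < r.+1) budget r' (candidates r' w))%:R
                  / V%:R)%:E | r in stops_at w].

End CoKernelFC.

(* Main.v *)
(* In round r, the noise in the estimated gap of two arms of one agent is a
   linear form in the fresh samples; by the rounding guarantee the squared norm
   of its coefficients is small enough for a Chernoff bound to keep it below
   2^-r / 2. The candidate sets depend on earlier rounds only, hence are
   independent of this noise, and a union bound over rounds and pairs of arms
   costs at most delta. The hypothesis on xi bounds the bias of the estimates by
   gap / 20, so on this event the best arms survive and the algorithm stops at
   the latest when 2^-r <= gap / 2.

   Up to that round the budgets are controlled by the maximum information gain Y:
   - rho <= 4 Y, by first-order optimality of the maximizing allocation;
   - dtilde <= 2 Y for every allocation, since det (1 + K / xi) is at least
     2 ^ dtilde;
   - Y >= 1/2, because the hypothesis on xi forces a large trace of the Gram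
     matrix; this absorbs the ceilings in the budgets.
   This gives (a). Splitting the spectrum of the Gram matrix at the effective
   dimension gives (b), and submultiplicativity of the rank under Hadamard
   products gives (c). *)
From HB Require Import structures.
Require Import Defs.
From mathcomp Require Import all_boot all_order all_algebra.
From mathcomp Require Import all_classical all_reals all_analysis.
From mathcomp Require Import measurable_realfun ring lra.

Set Implicit Arguments.
Unset Strict Implicit.
Unset Printing Implicit Defensive.

Import Order.TTheory GRing.Theory Num.Theory.
Import numFieldNormedType.Exports.

Local Open Scope classical_set_scope.
Local Open Scope ring_scope.

(** * Linear algebra *)

(** [H] may be infinite dimensional and carries only a bilinear form, and [op_inv] picks a preimage
    by choice. So operator facts are either pulled back to the finite Gram matrix (existence of the
    inverse, the estimator formula) or derived from Cauchy-Schwarz for the regularized form.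
    Matrices are not diagonalized either: the spectrum is a list of roots of the characteristic
    polynomial, so determinants and ranks are handled by block factorizations. On the probabilistic
    side the obstacle is adaptivity: the budgets and coefficients of a round depend on random
    candidate sets. For a fixed [B] they are deterministic, so concentration is proved for every [B]
    and every round, and [B] is replaced by the random set only at the end, by independence. A last
    round m with 2^-m <= gap / 2 is fixed in advance, so the good event concerns finitely many
    rounds. *)

(** Sylvester's identity, from two triangular factorizations of one block matrix. *)
Lemma det_1mulmxC (A : comNzRingType) m r (B : 'M[A]_(m, r)) (C : 'M[A]_(r, m)) :
  \det (1%:M + B *m C) = \det (1%:M + C *m B).
Proof.
have E1 : block_mx 1%:M (- B) C 1%:M
    = block_mx 1%:M 0 C 1%:M *m block_mx 1%:M (- B) 0 (1%:M + C *m B).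
  by rewrite mulmx_block !(mul1mx, mulmx1, mul0mx, mulmx0, addr0, add0r)
    mulmxN addrCA addNr addr0.
have E2 : block_mx 1%:M (- B) C 1%:M
    = block_mx (1%:M + B *m C) (- B) 0 1%:M *m block_mx 1%:M 0 C 1%:M.
  by rewrite mulmx_block !(mul1mx, mulmx1, mul0mx, mulmx0, addr0, add0r)
    mulNmx addrK.
move: E2; rewrite E1 => /(congr1 determinant).
by rewrite !det_mulmx !(det_lblock, det_ublock) !det1 !(mul1r, mulr1).
Qed.

(** The nonzero eigenvalues of [B *m C] and [C *m B] agree with multiplicity; stated without
    division so that it holds for any m and r. *)
Lemma char_poly_mulmxC (A : comNzRingType) m r (B : 'M[A]_(m, r)) (C : 'M[A]_(r, m)) :
  char_poly (B *m C) * 'X^r = 'X^m * char_poly (C *m B).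
Proof.
rewrite /char_poly /char_poly_mx !map_mxM.
set b := map_mx _ B; set c := map_mx _ C.
have E1 : block_mx 'X%:M b c 1%:M *m block_mx 1%:M 0 (- c) 1%:M
    = block_mx ('X%:M - b *m c) b 0 1%:M.
  by rewrite mulmx_block !(mul1mx, mulmx1, mul0mx, mulmx0, addr0, add0r)
    mulmxN subrr.
have E2 : block_mx 'X%:M b c 1%:M *m block_mx 1%:M (- b) 0 'X%:M
    = block_mx 'X%:M 0 c ('X%:M - c *m b).
  rewrite mulmx_block !(mul1mx, mulmx1, mul0mx, mulmx0, addr0, add0r) !mulmxN.
  by rewrite mul_scalar_mx mul_mx_scalar addNr addrC.
move: E1 E2 => /(congr1 determinant) + /(congr1 determinant).
rewrite !det_mulmx !(det_lblock, det_ublock) !det1 !det_scalar !(mul1r, mulr1).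
by move=> -> ->.
Qed.

Section Spectrum.
Variable F : fieldType.

Lemma mup0_prod_XsubC (s : seq F) :
  mup 0 (\prod_(a <- s) ('X - a%:P)) = count_mem 0 s.
Proof.
elim: s => [|a s IHs]; first by rewrite big_nil mupNroot // root1.
rewrite big_cons mupM ?polyXsubC_eq0 ?IHs /=; last first.
- by rewrite monic_neq0 // monic_prod_XsubC.
- by [].
have := mup_XsubCX 1 0 a; rewrite expr1 => ->.
by case: eqP.
Qed.

(** Write K as a product through dimension [\rank K] and compare the multiplicities of the root 0 in
    [char_poly_mulmxC]: at least m - [\rank K] eigenvalues vanish. *)
Lemma count_eigenvalue_neq0 m (K : 'M[F]_m) (s : seq F) :
  char_poly K = \prod_(a <- s) ('X - a%:P) ->
  (count (fun a => a != 0%R) s <= \rank K)%N.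
Proof.
move=> Ks; set r := \rank K.
have sm : size s = m.
  have := size_char_poly K; rewrite Ks size_prod_XsubC => -[] //.
have := char_poly_mulmxC (col_base K) (row_base K).
rewrite mulmx_base Ks => /(congr1 (mup 0)).
have p0 n : 'X^n != 0 :> {poly F} by rewrite -size_poly_gt0 size_polyXn.
have mX n : mup 0 ('X^n : {poly F}) = n.
  by have := mup_XsubCX n (0 : F) 0; rewrite polyC0 subr0 eqxx.
rewrite !mupM ?mup0_prod_XsubC ?mX //; last 2 first.
- by rewrite monic_neq0 // char_poly_monic.
- by rewrite monic_neq0 // monic_prod_XsubC.
move=> E.
rewrite -(leq_add2l (count_mem 0%R s)) [in leqRHS]E.
by rewrite (count_predC (pred1 (0 : F)) s) sm leq_addr.
Qed.

Lemma det_1scale_spectrum m (K : 'M[F]_m) (s : seq F) (c : F) :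
  char_poly K = \prod_(a <- s) ('X - a%:P) ->
  \det (1%:M + c *: K) = \prod_(a <- s) (1 + c * a).
Proof.
move=> Ks; have sm : size s = m.
  have := size_char_poly K; rewrite Ks size_prod_XsubC => -[] //.
have [->|c0] := eqVneq c 0.
  rewrite scale0r addr0 det1 big1_seq // => a _; by rewrite mul0r addr0.
(* Up to the factor (-c)^m, det (1 + c K) is the characteristic polynomial at -1/c. *)
have := congr1 (fun p => p.[- c^-1]) Ks.
rewrite /char_poly -horner_evalE -det_map_mx horner_prod.
have -> : map_mx (horner_eval (- c^-1)) (char_poly_mx K)
    = - c^-1 *: (1%:M + c *: K).
  apply/matrixP => i j; rewrite !mxE /horner_eval !hornerE hornerMn hornerX.
  by case: (i == j); rewrite ?mulr1n ?mulr0n /=; field.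
rewrite detZ => E.
have -> : \prod_(a <- s) (1 + c * a) = (- c) ^+ m * \prod_(a <- s) ('X - a%:P).[- c^-1].
  rewrite -sm; elim: (s) => [|a t IHt]; first by rewrite !big_nil mul1r.
  rewrite !big_cons IHt /= exprS mulrACA; congr (_ * _).
  by rewrite !hornerE; field.
by rewrite -E mulrA -exprMn mulrNN mulfV // expr1n mul1r.
Qed.

(** Expanding both factors along their rank factorizations writes the entrywise product as a sum of
    [\rank A * \rank B] matrices of rank at most one. *)
Lemma mxrank_hadamard m (A B : 'M[F]_m) :
  (\rank (\matrix_(i, j) (A i j * B i j)%R) <= \rank A * \rank B)%N.
Proof.
pose u (p : 'I_(\rank A)) (q : 'I_(\rank B)) : 'cV[F]_m :=
  \col_i (col_base A i p * col_base B i q).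
pose v (p : 'I_(\rank A)) (q : 'I_(\rank B)) : 'rV[F]_m :=
  \row_j (row_base A p j * row_base B q j).
have -> : \matrix_(i, j) (A i j * B i j) = \sum_p \sum_q (u p q *m v p q).
  apply/matrixP => i j; rewrite !mxE -{1}(mulmx_base A) -{1}(mulmx_base B) !mxE.
  rewrite big_distrlr summxE; apply: eq_bigr => p _; rewrite summxE.
  by apply: eq_bigr => q _; rewrite !mxE big_ord1 !mxE mulrACA.
have rs (I : finType) (G : I -> 'M[F]_m) c : (forall i, \rank (G i) <= c)%N ->
    (\rank (\sum_i G i)%R <= #|I| * c)%N.
  move=> Gc; rewrite -sum_nat_const.
  apply: (big_ind2 (fun (x : 'M[F]_m) y => (\rank x <= y)%N)) => //.
    by rewrite mxrank0.
  by move=> x1 x2 y1 y2 h1 h2; rewrite (leq_trans (mxrank_add _ _)) // leq_add.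
have := rs _ (fun p => \sum_q (u p q *m v p q)) (\rank B); rewrite card_ord.
apply=> p; have := rs _ (fun q => u p q *m v p q) 1%N; rewrite card_ord muln1.
apply=> q; by rewrite (leq_trans (mxrankM_maxl _ _)) // rank_leq_col.
Qed.

End Spectrum.

(** * Positive semidefinite matrices *)

Section PositiveSemidefinite.
Variable R : realFieldType.

Definition psd m (A : 'M[R]_m) := forall x : 'rV_m, 0 <= (x *m A *m x^T) 0 0.

(** The discriminant bound behind both Cauchy-Schwarz inequalities below and the 2 x 2 minor
    inequality for positive semidefinite matrices. *)
Lemma quadratic_ge0 (a b c : R) : 0 <= a ->
  (forall y, 0 <= a * y ^+ 2 + 2 * b * y + c) -> b ^+ 2 <= a * c.
Proof.
move=> a0 h; have [a00|an0] := eqVneq a 0.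
  have [->|b0] := eqVneq b 0; first by rewrite a00 expr0n mul0r.
  (* At this point the affine expression takes the value -1. *)
  have := h (- (c + 1) / (2 * b)); rewrite a00 mul0r add0r.
  rewrite mulrC divfK ?mulf_neq0 ?pnatr_eq0 //; lra.
have ap : 0 < a by rewrite lt_def an0.
have := h (- b / a).
have -> : a * (- b / a) ^+ 2 + 2 * b * (- b / a) + c = (a * c - b ^+ 2) / a.
  by field.
by rewrite pmulr_lge0 ?invr_gt0 // subr_ge0.
Qed.

Lemma psd_diag_ge0 m (A : 'M[R]_m) i : psd A -> 0 <= A i i.
Proof.
move=> /(_ (delta_mx 0 i)).
by rewrite -rowE trmx_delta -colE !mxE.
Qed.

(* Induction on the size, splitting off the first row and column of [1 + A]:
   its Schur complement is again of the form [1 + P] with [P] positive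
   semidefinite, and the 2 x 2 minors of [A] control the loss in trace. *)
Lemma det_1psd m (A : 'M[R]_m) : A^T = A -> psd A ->
  1 + \tr A <= \det (1%:M + A).
Proof.
elim: m A => [|m IHm] A.
  by move=> _ _; rewrite det_mx00 /mxtrace big_ord0 addr0.
move: A; rewrite -[m.+1]/(1 + m)%N => A As Ap.
have := As; have := Ap; rewrite -(submxK A).
move: (ulsubmx A) (ursubmx A) (dlsubmx A) (drsubmx A) => a' b b' A' psA.
rewrite tr_block_mx => /eq_block_mx [_ bE _ A's] {A As Ap}.
have b'E : b' = b^T by rewrite -bE trmxK.
move: psA; rewrite {}b'E {bE b'} => psA.
rewrite (mx11_scalar a') in psA *; move: (a' 0 0 : R) psA => a psA {a'}.
have val (y : R) (x : 'rV_m) :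
    0 <= a * y ^+ 2 + 2 * (x *m b^T) 0 0 * y + (x *m A' *m x^T) 0 0.
  have := psA (row_mx y%:M x).
  rewrite mul_row_block tr_row_mx mul_row_col tr_scalar_mx !mulmxDl.
  rewrite !mul_mx_scalar !mul_scalar_mx -scalemxAl !mxE !eqxx.
  have -> : (\sum_j b 0 j * x^T j 0) = \sum_j x 0 j * b^T j 0.
    by apply: eq_bigr => j _; rewrite !mxE mulrC.
  move=> h; apply: le_trans h _; rewrite le_eqVlt; apply/orP; left; apply/eqP.
  by rewrite /=; ring.
have a0 : 0 <= a.
  have : 0 <= (block_mx a%:M b b^T A') (lshift m 0) (lshift m 0).
    exact: psd_diag_ge0.
  by rewrite block_mxEul mxE eqxx.
have a1 : 1 + a != 0 by rewrite gt_eqF // ltr_wpDr.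
pose P := A' - (1 + a)^-1 *: (b^T *m b).
have E : block_mx 1%:M 0 (- (1 + a)^-1 *: b^T) 1%:M
    *m (1%:M + block_mx a%:M b b^T A')
    = block_mx (1 + a)%:M b 0 (1%:M + P).
  rewrite (@scalar_mx_block _ 1 m) add_block_mx -raddfD /=.
  rewrite mulmx_block !(mul1mx, mulmx1, mul0mx, mulmx0, addr0, add0r).
  rewrite mul_mx_scalar scalerA mulrN mulfV // scaleN1r addNr.
  by rewrite -scalemxAl scaleNr [in X in block_mx _ _ _ X = _]addrC -addrA.
have {E} := congr1 determinant E.
rewrite det_mulmx det_lblock det_ublock !det1 !mul1r det_scalar expr1 => ->.
have Ps : P^T = P.
  by rewrite /P linearB /= linearZ /= trmx_mul trmxK A's.
have Pp : psd P.
  move=> x; set s := (x *m b^T) 0 0.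
  have := val (- s / (1 + a)) x; rewrite -/s.
  have -> : (x *m P *m x^T) 0 0 = (x *m A' *m x^T) 0 0 - s ^+ 2 / (1 + a).
    rewrite mulmxBr mulmxBl -scalemxAr -scalemxAl mulmxA.
    rewrite -(mulmxA (x *m b^T)) [x *m b^T]mx11_scalar mul_scalar_mx.
    have -> : b *m x^T = (x *m b^T)^T by rewrite trmx_mul trmxK.
    by rewrite [x *m b^T]mx11_scalar -/s tr_scalar_mx !mxE mulr1n mulrC.
  move=> h; apply: le_trans h _.
  rewrite addrC lerD2l -subr_ge0.
  have -> : - (s ^+ 2 / (1 + a)) - (a * (- s / (1 + a)) ^+ 2 + 2 * s * (- s / (1 + a)))
     = (s / (1 + a)) ^+ 2 by field.
  exact: sqr_ge0.
have trb : \tr (b^T *m b) = \sum_i (b 0 i) ^+ 2.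
  by apply: eq_bigr => i _; rewrite !mxE big_ord1 !mxE expr2.
have bnd : \tr (b^T *m b) <= a * \tr A'.
  rewrite trb /mxtrace mulr_sumr; apply: ler_sum => i _.
  apply: quadratic_ge0 => // y.
  have := val y (delta_mx 0 i).
  by rewrite -!rowE trmx_delta -colE !mxE.
have tA' : \tr P = \tr A' - (1 + a)^-1 * \tr (b^T *m b).
  by rewrite linearB /= linearZ.
rewrite (@mxtrace_block _ 1 m) mxtrace_scalar mulr1n.
have : (1 + a) * (1 + \tr P) <= (1 + a) * \det (1%:M + P).
  by apply: ler_wpM2l; [rewrite addr_ge0|exact: IHm].
rewrite tA' mulrDr mulr1 mulrBr mulrA mulfV // mul1r.
move: bnd; clear; lra.
Qed.

Lemma det_1psd_ge1 m (A : 'M[R]_m) : A^T = A -> psd A -> 1 <= \det (1%:M + A).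
Proof.
move=> As Ap; apply: le_trans (det_1psd As Ap).
by rewrite lerDl sumr_ge0 // => i _; apply: psd_diag_ge0.
Qed.

Lemma psdZ m (A : 'M[R]_m) c : 0 <= c -> psd A -> psd (c *: A).
Proof. by move=> c0 Ap x; rewrite -scalemxAr -scalemxAl mxE mulr_ge0. Qed.

Lemma psd_add_scalar_unit m (A : 'M[R]_m) c : 0 < c -> A^T = A -> psd A ->
  A + c%:M \in unitmx.
Proof.
move=> c0 As Ap.
have -> : A + c%:M = c *: (1%:M + c^-1 *: A).
  by rewrite scalerDr scalerA mulfV ?gt_eqF // scale1r scalemx1 addrC.
rewrite unitmxZ ?unitfE ?gt_eqF // unitmxE unitfE gt_eqF //.
apply: lt_le_trans ltr01 (det_1psd_ge1 _ _); first by rewrite linearZ /= As.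
by apply: psdZ => //; rewrite invr_ge0 ltW.
Qed.

Lemma psd_spectrum_ge0 m (K : 'M[R]_m) (s : seq R) : psd K ->
  char_poly K = \prod_(a <- s) ('X - a%:P) -> {in s, forall a, 0 <= a}.
Proof.
move=> Kp Ks a sa.
have : eigenvalue K a by rewrite eigenvalue_root_char Ks root_prod_XsubC.
move=> /eigenvalueP [v vK v0].
have := Kp v; rewrite vK -scalemxAl mxE.
suff vp : 0 < (v *m v^T) 0 0 by rewrite pmulr_lge0.
have vE : (v *m v^T) 0 0 = \sum_j v 0 j ^+ 2.
  by rewrite mxE; apply: eq_bigr => j _; rewrite mxE expr2.
rewrite lt_def vE sumr_ge0 ?andbT => [|j _]; last exact: sqr_ge0.
apply: contra_neq v0 => /eqP; rewrite psumr_eq0 => [/allP h|j _]; last exact: sqr_ge0.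
apply/rowP => j; rewrite mxE.
by have := h j (mem_index_enum _); rewrite /= sqrf_eq0 => /eqP.
Qed.

(* Since [U] kills the complement [K' := K - U^T D U], which is positive
   semidefinite, [1 + c K] factors as [(1 + c K') (1 + c U^T D U)]. *)
Lemma det_1scale_eigenvectors m r (K : 'M[R]_m) (U : 'M[R]_(r, m)) (D : 'rV_r) c :
  0 <= c -> K^T = K -> psd K -> U *m U^T = 1%:M -> U *m K = diag_mx D *m U ->
  (forall i, 0 <= D 0 i) ->
  \prod_i (1 + c * D 0 i) <= \det (1%:M + c *: K).
Proof.
move=> c0 Ks Kp UU UK D0.
have KU : K *m U^T = U^T *m diag_mx D.
  by rewrite -{1}Ks -trmx_mul UK trmx_mul tr_diag_mx.
pose K' := K - U^T *m diag_mx D *m U.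
have K'U : K' *m U^T = 0.
  by rewrite mulmxBl KU -(mulmxA _ U) UU mulmx1 subrr.
have K's : K'^T = K'.
  by rewrite /K' linearB /= !trmx_mul trmxK tr_diag_mx Ks mulmxA.
have K'p : psd K'.
  move=> x; have := Kp (x *m (1%:M - U^T *m U)).
  have -> : (x *m (1%:M - U^T *m U))^T = (1%:M - U^T *m U) *m x^T.
    by rewrite trmx_mul linearB /= trmx1 trmx_mul trmxK.
  rewrite !mulmxA -(mulmxA x) -(mulmxA x).
  suff -> : (1%:M - U^T *m U) *m K *m (1%:M - U^T *m U) = K' by [].
  rewrite -mulmxA mulmxBr mulmx1 mulmxA KU -/K' mulmxBl mul1mx -mulmxA.
  by rewrite /K' mulmxBr UK !mulmxA UU mul1mx subrr mulmx0 subr0.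
suff E : 1%:M + c *: K
    = (1%:M + c *: K') *m (1%:M + U^T *m ((c *: diag_mx D) *m U)).
rewrite E det_mulmx det_1mulmxC -mulmxA UU mulmx1.
have -> : \det (1%:M + c *: diag_mx D) = \prod_i (1 + c * D 0 i).
  have -> : 1%:M + c *: diag_mx D = diag_mx (\row_i (1 + c * D 0 i)).
    apply/matrixP => i j; rewrite !mxE.
    by case: eqP => _; rewrite ?mulr1n ?mulr0n ?mulr0 ?addr0.
  by rewrite det_diag; apply: eq_bigr => i _; rewrite mxE.
rewrite ler_peMl ?prodr_ge0 // => [i _|]; first by rewrite addr_ge0 ?mulr_ge0.
apply: det_1psd_ge1; first by rewrite linearZ /= K's.
exact: psdZ.
rewrite mulmxDr mulmx1 !mulmxDl !mul1mx (mulmxA (c *: K')).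
rewrite -(scalemxAl c K') K'U scaler0 mul0mx addr0 -addrA; congr (_ + _).
by rewrite -scalemxAl -scalemxAr -scalerDr mulmxA subrK.
Qed.

End PositiveSemidefinite.

(** * Regularized covariance operators *)

Section InnerProduct.
Context {R : realType} {H : lmodType R}.
Variable dot : {dot H for idfun}.

Lemma dotC h g : dot h g = dot g h.
Proof. by have := hermC dot h g; rewrite expr0 mul1r. Qed.

Lemma dotDl h h' g : dot (h + h') g = dot h g + dot h' g.
Proof. exact: linearDl. Qed.

Lemma dotDr g h h' : dot g (h + h') = dot g h + dot g h'.
Proof. exact: linearDr. Qed.

Lemma dotZl c h g : dot (c *: h) g = c * dot h g.
Proof. exact: linearZl_LR. Qed.

Lemma dotZr c h g : dot g (c *: h) = c * dot g h.
Proof. by rewrite dotC dotZl dotC. Qed.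

Lemma dotBl h h' g : dot (h - h') g = dot h g - dot h' g.
Proof. exact: linearBl. Qed.

Lemma dotBr g h h' : dot g (h - h') = dot g h - dot g h'.
Proof. exact: linearBr. Qed.

Lemma dot0r h : dot h 0 = 0.
Proof. exact: linear0r. Qed.

Lemma dot_suml (I : finType) (f : I -> H) g :
  dot (\sum_i f i) g = \sum_i dot (f i) g.
Proof. exact: linear_sumlz. Qed.

Lemma dot_sumr (I : finType) (f : I -> H) g :
  dot g (\sum_i f i) = \sum_i dot g (f i).
Proof. exact: linear_sumr. Qed.

Lemma dot_eq0 h : (dot h h == 0) = (h == 0).
Proof.
have [->|h0] := eqVneq h 0; first by rewrite dot0r eqxx.
by rewrite gt_eqF // neq0_dnorm_gt0.
Qed.

Lemma dot_ge0 h : 0 <= dot h h.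
Proof.
have [->|h0] := eqVneq h 0; first by rewrite dot0r.
exact/ltW/neq0_dnorm_gt0.
Qed.

Lemma dot_CauchySchwarz h g : dot h g ^+ 2 <= dot h h * dot g g.
Proof.
apply: quadratic_ge0 => [|y]; first exact: dot_ge0.
have := dot_ge0 (y *: h + g); rewrite !(dotDl, dotDr, dotZl, dotZr) (dotC g h).
by congr (0 <= _); ring.
Qed.

End InnerProduct.

Lemma sum_enum_val (A : nmodType) (I : finType) (f : I -> A) :
  \sum_(i < #|{: I}|) f (enum_val i) = \sum_a f a.
Proof. by rewrite -(big_enum_val (op := +%R) (A := {: I}) f). Qed.

Section RegularizedOperator.
Context {R : realType} {H : lmodType R} {V n : nat}.
Variables (dot : {dot H for idfun}) (feat : arm V n -> H).
Implicit Types (c t : R) (w : arm V n -> R) (h g : H) (a : arm V n).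

(** Common form of the three operators of the problem: [reg_op] has c = xi and w = lambda,
    [planned_op] scales both by N, and [sampled_op] has c = N xi and the pull counts as weights. *)
Definition regop c w : H -> H :=
  fun g => c *: g + \sum_a w a *: rank1 dot (feat a) g.

Definition gram a b : R := dot (feat a) (feat b).

Definition invq c w h : R := dot h (op_inv (regop c w) h).

Lemma dot_regop c w h g : dot h (regop c w g) =
  c * dot h g + \sum_a w a * (dot (feat a) h * dot (feat a) g).
Proof.
rewrite /regop dotDr dotZr dot_sumr; congr (_ + _); apply: eq_bigr => a _.
by rewrite /rank1 !dotZr (dotC dot h) (mulrC (dot (feat a) g)).
Qed.

Lemma dot_regopC c w h g : dot h (regop c w g) = dot (regop c w h) g.
Proof.
rewrite (dotC dot (regop c w h)) !dot_regop (dotC dot g); congr (_ + _).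
by apply: eq_bigr => a _; rewrite (mulrC (dot (feat a) h)).
Qed.

Lemma regopZD c w t h g : regop c w (t *: h + g) = t *: regop c w h + regop c w g.
Proof.
rewrite /regop !scalerDr addrACA !scalerA (mulrC c t); congr (_ + _).
rewrite scaler_sumr -big_split; apply: eq_bigr => a _ /=.
rewrite /rank1 dotDr dotZr !scalerA -scalerDl; congr (_ *: _); ring.
Qed.

Lemma regopB c w h g : regop c w (h - g) = regop c w h - regop c w g.
Proof. by rewrite -scaleN1r [h + _]addrC regopZD scaleN1r addrC. Qed.

Lemma trmx_weighted_gram w : (weighted_gram gram w)^T = weighted_gram gram w.
Proof.
by apply/matrixP => i j; rewrite !mxE mulrC /gram dotC mulrC (mulrC (w _)).
Qed.

Section NonnegativeWeights.
Variables (c : R) (w : arm V n -> R).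
Hypotheses (c0 : 0 < c) (w0 : forall a, 0 <= w a).

Lemma weighted_gramE i j : weighted_gram gram w i j =
  Num.sqrt (w (enum_val i)) * Num.sqrt (w (enum_val j))
  * dot (feat (enum_val i)) (feat (enum_val j)).
Proof. by rewrite mxE sqrtrM. Qed.

Lemma psd_weighted_gram : psd (weighted_gram gram w).
Proof.
move=> x.
pose h := \sum_(i < #|{: arm V n}|)
  (x 0 i * Num.sqrt (w (enum_val i))) *: feat (enum_val i).
suff -> : (x *m weighted_gram gram w *m x^T) 0 0 = dot h h by exact: dot_ge0.
rewrite mxE /h dot_sumr; apply: eq_bigr => j _.
rewrite !mxE dotZr dot_suml mulrC -mulrA; congr (_ * _).
rewrite mulr_sumr; apply: eq_bigr => i _.
by rewrite weighted_gramE dotZl; ring.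
Qed.

Lemma weighted_gram_mulmx (x : 'cV[R]_#|{: arm V n}|) i :
  (weighted_gram gram w *m x) i 0 = Num.sqrt (w (enum_val i))
  * dot (feat (enum_val i))
    (\sum_(j < #|{: arm V n}|)
       (Num.sqrt (w (enum_val j)) * x j 0) *: feat (enum_val j)).
Proof.
rewrite mxE dot_sumr mulr_sumr; apply: eq_bigr => j _.
by rewrite weighted_gramE dotZr; ring.
Qed.

Lemma gram_add_scalar_unit : weighted_gram gram w + c%:M \in unitmx.
Proof.
apply: psd_add_scalar_unit => //; first exact: trmx_weighted_gram.
exact: psd_weighted_gram.
Qed.

Lemma regop_inj g g' : regop c w g = regop c w g' -> g = g'.
Proof.
move=> E; apply/eqP; rewrite -subr_eq0 -(dot_eq0 dot).
have : dot (g - g') (regop c w (g - g')) = 0.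
  by rewrite regopB E subrr dot0r.
rewrite dot_regop => /eqP; rewrite paddr_eq0; last 2 first.
- by rewrite mulr_ge0 ?dot_ge0 // ltW.
- by apply: sumr_ge0 => a _; rewrite mulr_ge0 // -expr2 sqr_ge0.
by rewrite mulf_eq0 gt_eqF //= => /andP [].
Qed.

(* The coordinates [s_a <phi_a, g>] of the solution solve a finite linear
   system whose matrix is the regularized Gram matrix. *)
Lemma regop_surj h : exists g, regop c w g = h.
Proof.
pose s (i : 'I_#|{: arm V n}|) := Num.sqrt (w (enum_val i)).
pose u : 'cV[R]_#|{: arm V n}| := \col_i (s i * dot (feat (enum_val i)) h).
pose x := invmx (weighted_gram gram w + c%:M) *m u.
have xu : weighted_gram gram w *m x + c *: x = u.
  rewrite -mul_scalar_mx -mulmxDl mulmxA mulmxV ?mul1mx //.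
  exact: gram_add_scalar_unit.
pose S := \sum_(j < #|{: arm V n}|) (s j * x j 0) *: feat (enum_val j).
exists (c^-1 *: (h - S)).
have sx i : s i * dot (feat (enum_val i)) (c^-1 *: (h - S)) = x i 0.
  have := congr1 (fun A : 'cV__ => A i 0) xu.
  rewrite mxE weighted_gram_mulmx -/(s i) -/S !mxE dotZr dotBr mulrCA mulrBr => <-.
  by rewrite addrAC subrr add0r mulKf ?gt_eqF.
rewrite /regop scalerA mulfV ?gt_eqF // scale1r.
rewrite -(sum_enum_val (fun a => w a *: rank1 dot (feat a) (c^-1 *: (h - S)))).
suff <- : S = \sum_(i < #|{: arm V n}|) w (enum_val i) *:
     rank1 dot (feat (enum_val i)) (c^-1 *: (h - S)) by rewrite subrK.
apply: eq_bigr => i _; rewrite -sx /rank1 scalerA mulrA; congr ((_ * _) *: _).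
by rewrite -expr2 sqr_sqrtr.
Qed.

Lemma op_invK h : regop c w (op_inv (regop c w) h) = h.
Proof.
rewrite /op_inv; have [g gh] := regop_surj h.
exact: (xgetPex 0 (ex_intro (fun g => regop c w g = h) g gh)).
Qed.

Lemma dot_op_invC h g :
  dot h (op_inv (regop c w) g) = dot (op_inv (regop c w) h) g.
Proof. by rewrite -{1}[h]op_invK -dot_regopC op_invK. Qed.

Lemma invqE h : invq c w h =
  c * dot (op_inv (regop c w) h) (op_inv (regop c w) h) +
  \sum_a w a * dot (feat a) (op_inv (regop c w) h) ^+ 2.
Proof.
rewrite /invq -{1}[h]op_invK -dot_regopC dot_regop.
by [].
Qed.

Lemma sum_weights_ge0 h : 0 <= \sum_a w a * dot (feat a) h ^+ 2.
Proof. by apply: sumr_ge0 => a _; rewrite mulr_ge0 ?sqr_ge0. Qed.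

Lemma regop_ge0 h : 0 <= dot h (regop c w h).
Proof.
rewrite dot_regop addr_ge0 ?mulr_ge0 ?dot_ge0 ?(ltW c0) //.
by apply: sumr_ge0 => a _; rewrite mulr_ge0 // -expr2 sqr_ge0.
Qed.

Lemma invq_ge0 h : 0 <= invq c w h.
Proof. by rewrite invqE addr_ge0 ?mulr_ge0 ?dot_ge0 ?(ltW c0) ?sum_weights_ge0. Qed.

Lemma sqr_inv_norm h : inv_norm dot (regop c w) h ^+ 2 = invq c w h.
Proof. by rewrite sqr_sqrtr // invq_ge0. Qed.

(** The left-hand side is the variance, under unit noise, of the ridge estimate of the linear
    functional [h]; [invqE] splits [invq] into it and a nonnegative penalty. *)
Lemma variance_le_invq h :
  \sum_a w a * dot (op_inv (regop c w) h) (feat a) ^+ 2 <= invq c w h.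
Proof.
rewrite invqE (eq_bigr (fun a => w a * dot (feat a) (op_inv (regop c w) h) ^+ 2)).
  by rewrite lerDr mulr_ge0 ?dot_ge0 ?(ltW c0).
by move=> a _; rewrite dotC.
Qed.

Lemma regop_CauchySchwarz h g :
  dot h (regop c w g) ^+ 2 <= dot h (regop c w h) * dot g (regop c w g).
Proof.
apply: quadratic_ge0; first exact: regop_ge0.
move=> y; have := regop_ge0 (y *: h + g).
rewrite regopZD; move: (dot_regopC c w g h); move: (regop c w h) (regop c w g) => mh mg E.
rewrite !(dotDl, dotDr, dotZl, dotZr) E (dotC _ mg).
by congr (0 <= _); ring.
Qed.

End NonnegativeWeights.

Section Bounds.
Variables (c : R) (w : arm V n -> R).
Hypotheses (c0 : 0 < c) (w0 : forall a, 0 <= w a).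

(** The left-hand side is the squared regularization bias when the truth is [g]. Cauchy-Schwarz
    reduces it to the penalty half of [invqE]. *)
Lemma bias_le_invq h g : (c * dot (op_inv (regop c w) h) g) ^+ 2
  <= c * invq c w h * dot g g.
Proof.
rewrite exprMn (le_trans (ler_wpM2l (sqr_ge0 c) (dot_CauchySchwarz dot _ _))) //.
rewrite mulrA ler_wpM2r ?dot_ge0 // expr2 -mulrA ler_wpM2l ?(ltW c0) //.
by rewrite invqE // lerDl sum_weights_ge0.
Qed.

(** Truth minus bias plus noise. The inverse is self-adjoint, so it can act on [h]; writing [h] as
    the operator applied to that preimage makes the signal parts cancel. *)
Lemma regression_decomposition h theta (e : arm V n -> R) :
  dot h (op_inv (regop c w) (\sum_a (w a * (dot (feat a) theta + e a)) *: feat a))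
  = dot h theta - c * dot (op_inv (regop c w) h) theta
    + \sum_a w a * e a * dot (op_inv (regop c w) h) (feat a).
Proof.
rewrite dot_op_invC //; set g := op_inv _ _.
rewrite -{1}[h](op_invK c0 w0) -/g -dot_regopC dot_regop.
rewrite (addrAC (c * _)) subrr add0r.
rewrite dot_sumr -big_split; apply: eq_bigr => a _ /=.
by rewrite dotZr (dotC dot g); ring.
Qed.

Lemma invq_scale (N : R) h : 0 < N ->
  invq (N * c) (fun a => N * w a) h = invq c w h / N.
Proof.
move=> N0; have E g : regop (N * c) (fun a => N * w a) g = N *: regop c w g.
  rewrite /regop scalerDr scalerA; congr (_ + _); rewrite scaler_sumr.
  by apply: eq_bigr => a _; rewrite scalerA.
have -> : invq c w h / N = dot h (N^-1 *: op_inv (regop c w) h).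
  by rewrite dotZr mulrC.
congr (dot h _); apply: (@regop_inj (N * c) (fun a => N * w a)).
- exact: mulr_gt0.
- by move=> a; rewrite mulr_ge0 ?(ltW N0).
rewrite op_invK; last 2 first.
- exact: mulr_gt0.
- by move=> a; rewrite mulr_ge0 ?(ltW N0).
rewrite E -[N^-1 *: _]addr0 regopZD op_invK //.
have -> : regop c w 0 = 0.
  rewrite /regop scaler0 add0r big1 // => a _.
  by rewrite /rank1 dot0r scale0r scaler0.
by rewrite addr0 scalerA mulfV ?gt_eqF // scale1r.
Qed.

(** The parallelogram law, with the nonnegative term at h + g dropped. *)
Lemma invqB h g : invq c w (h - g) <= 2 * invq c w h + 2 * invq c w g.
Proof.
have Ex : op_inv (regop c w) (h - g) = op_inv (regop c w) h - op_inv (regop c w) g.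
  by apply: (regop_inj c0 w0); rewrite regopB !op_invK.
have := regop_ge0 c0 w0 (1 *: op_inv (regop c w) h + op_inv (regop c w) g).
rewrite regopZD !(op_invK c0 w0) /invq Ex !scale1r.
rewrite !(dotBl, dotBr, dotDl, dotDr) !(dotC _ (op_inv _ _)) => h0.
rewrite -subr_ge0; apply: le_trans h0 _; rewrite le_eqVlt; apply/orP; left.
by apply/eqP; ring.
Qed.

(** The operator is at most its regularizer plus the trace of the covariance, hence its inverse is
    at least the reciprocal. The order reversal comes from Cauchy-Schwarz for the regularized form
    between [h] and its preimage. *)
Lemma dot_le_invq h :
  dot h h <= (c + \sum_a w a * dot (feat a) (feat a)) * invq c w h.
Proof.
have [->|h0] := eqVneq h 0.
  by rewrite dot0r mulr_ge0 ?invq_ge0 // addr_ge0 ?(ltW c0) // sumr_ge0 // => a _;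
    rewrite mulr_ge0 ?dot_ge0.
have hp : 0 < dot h h by rewrite lt_def dot_eq0 h0 dot_ge0.
have := regop_CauchySchwarz c0 w0 h (op_inv (regop c w) h).
rewrite op_invK // (dotC _ (op_inv _ _) h) -/(invq c w h) => B.
have : dot h (regop c w h) <= (c + \sum_a w a * dot (feat a) (feat a)) * dot h h.
  rewrite dot_regop mulrDl lerD2l mulr_suml ler_sum // => a _.
  by rewrite -mulrA ler_wpM2l // -expr2 dot_CauchySchwarz.
move=> /(ler_wpM2r (invq_ge0 c0 w0 h)) /(le_trans B).
by rewrite expr2 mulrAC ler_pM2r.
Qed.

(** Inversion is antitone. Cauchy-Schwarz for the smaller form, applied to the preimages of [h]
    under the two operators, gives q^2 <= q q'. *)
Lemma invq_anti w' h : (forall a, 0 <= w' a <= w a) ->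
  invq c w h <= invq c w' h.
Proof.
move=> ww'; have w'0 a : 0 <= w' a by case/andP: (ww' a).
set g := op_inv (regop c w) h; set g' := op_inv (regop c w') h.
have Eh : invq c w h = dot g (regop c w g) by rewrite /invq op_invK // dotC.
have Eh' : invq c w' h = dot g' (regop c w' g') by rewrite /invq op_invK // dotC.
have [q0|q0] := eqVneq (invq c w h) 0; first by rewrite q0 invq_ge0.
have qp : 0 < invq c w h by rewrite lt_def q0 invq_ge0.
have := regop_CauchySchwarz c0 w'0 g g'.
rewrite -Eh' op_invK // dotC -/(invq c w h) => B.
have : dot g (regop c w' g) <= invq c w h.
  rewrite Eh !dot_regop lerD2l ler_sum // => a _; rewrite ler_wpM2r //.
    by rewrite -expr2 sqr_ge0.
  by case/andP: (ww' a).
move=> /(ler_wpM2r (invq_ge0 c0 w'0 h)) /(le_trans B).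
by rewrite expr2 ler_pM2l.
Qed.

(** Representer formula: the matrix expression computed by the algorithm is a linear functional of
    the ridge regression solution in [H]. *)
Lemma kernel_trick h (y : arm V n -> R) :
  ((\col_i (Num.sqrt (w (enum_val i)) * dot h (feat (enum_val i))))^T
   *m invmx (weighted_gram gram w + c%:M)
   *m \col_i (Num.sqrt (w (enum_val i)) * y (enum_val i))) ord0 ord0
  = dot h (op_inv (regop c w) (\sum_a (w a * y a) *: feat a)).
Proof.
set g := op_inv _ _; set u := \col_i (_ * y _).
have gE : c *: g = \sum_a (w a * (y a - dot (feat a) g)) *: feat a.
  have : regop c w g = \sum_a (w a * y a) *: feat a by rewrite op_invK.
  move=> /(canRL (addrK _)) ->; rewrite -sumrB; apply: eq_bigr => a _.
  by rewrite /rank1 scalerA -scalerBl mulrBr.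
(* The weighted residuals divided by c are the coordinates of the ridge solution on the features,
   and they solve the regularized Gram system. *)
pose x : 'cV[R]_#|{: arm V n}| := \col_i (Num.sqrt (w (enum_val i))
  * (y (enum_val i) - dot (feat (enum_val i)) g) / c).
have sumE : \sum_(j < #|{: arm V n}|)
    (Num.sqrt (w (enum_val j)) * x j 0) *: feat (enum_val j) = g.
  apply: (@scalerI _ _ c); first by rewrite gt_eqF.
  rewrite gE -(sum_enum_val (fun a => (w a * (y a - dot (feat a) g)) *: feat a)).
  rewrite scaler_sumr; apply: eq_bigr => j _; rewrite scalerA mxE.
  congr (_ *: _); rewrite -[in RHS](sqr_sqrtr (w0 (enum_val j))); field.
  by rewrite gt_eqF.
have xu : (weighted_gram gram w + c%:M) *m x = u.
  rewrite mulmxDl mul_scalar_mx; apply/colP => i.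
  rewrite mxE weighted_gram_mulmx // sumE !mxE; field.
  by rewrite gt_eqF.
rewrite -mulmxA -xu mulKmx; last exact: gram_add_scalar_unit.
rewrite mxE -[in RHS]sumE dot_sumr; apply: eq_bigr => i _.
by rewrite dotZr !mxE; ring.
Qed.

End Bounds.

Section Determinant.
Variable c : R.
Hypothesis c0 : 0 < c.

(** Moving both square roots to one side makes the matrix linear in the weights, column by column,
    so that adding mass at one arm becomes a rank-one update. *)
Lemma det_1gram t w : (forall a, 0 <= w a) ->
  \det (1%:M + t *: weighted_gram gram w) =
  \det (1%:M + t *: \matrix_(i < #|{: arm V n}|, j < #|{: arm V n}|)
                       (gram (enum_val i) (enum_val j) * w (enum_val j))).
Proof.
move=> w0; pose S : 'rV[R]_#|{: arm V n}| := \row_i Num.sqrt (w (enum_val i)).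
pose G : 'M[R]_#|{: arm V n}| := \matrix_(i, j) gram (enum_val i) (enum_val j).
have -> : weighted_gram gram w = diag_mx S *m (G *m diag_mx S).
  by apply/matrixP => i j; rewrite weighted_gramE // mul_diag_mx mxE mul_mx_diag !mxE; ring.
rewrite scalemxAr det_1mulmxC -scalemxAl -mulmxA mulmx_diag.
congr (\det (_ + _ *: _)); apply/matrixP => i j.
by rewrite mul_mx_diag !mxE -expr2 sqr_sqrtr.
Qed.

(** The matrix determinant lemma: only the column of [a] changes, and the resulting factor is
    expressed through the operator inverse in [H]. *)
Lemma det_1gram_add w t a : (forall b, 0 <= w b) -> 0 <= t ->
  \det (1%:M + c^-1 *: weighted_gram gram (fun b => w b + t * (b == a)%:R)) =
  \det (1%:M + c^-1 *: weighted_gram gram w) * (1 + t * invq c w (feat a)).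
Proof.
move=> w0 t0; rewrite !det_1gram //; last first.
  by move=> b; rewrite addr_ge0 // mulr_ge0 // ler0n.
set W := \matrix_(i, j) (_ * w _); set W' := \matrix_(i, j) _.
set g := op_inv (regop c w) (feat a).
pose v : 'cV[R]_#|{: arm V n}| := \col_i dot (feat (enum_val i)) g.
pose e : 'rV[R]_#|{: arm V n}| := \row_i (enum_val i == a)%:R.
(* The inner products of the features with the preimage of [feat a] solve the linear system whose
   right-hand side is the scaled Gram column of [a]. *)
have Nv i : ((1%:M + c^-1 *: W) *m v) i 0 = c^-1 * gram (enum_val i) a.
  rewrite mulmxDl mul1mx -scalemxAl !mxE.
  have -> : gram (enum_val i) a = dot (feat (enum_val i)) (regop c w g).
    by rewrite op_invK.
  rewrite dot_regop mulrDr mulKf ?gt_eqF //; congr (_ + c^-1 * _).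
  rewrite -(sum_enum_val (fun b => w b * (dot (feat b) (feat (enum_val i)) * dot (feat b) g))).
  by apply: eq_bigr => j _; rewrite !mxE /gram dotC; ring.
have -> : 1%:M + c^-1 *: W' = (1%:M + c^-1 *: W) *m (1%:M + (t *: v) *m e).
  rewrite mulmxDr mulmx1 mulmxA -addrA; congr (_ + _).
  apply/matrixP => i j; rewrite [RHS]mxE [(_ *m e) i j]mxE big_ord1 -scalemxAr.
  rewrite [(t *: (_ *m v)) _ _]mxE Nv !mxE.
  have [->|] := eqVneq (enum_val j) a; first by rewrite /=; ring.
  by rewrite /=; move=> _; ring.
rewrite det_mulmx det_1mulmxC; congr (_ * _).
rewrite det_mx11 !mxE eqxx mulr1n; congr (_ + _).
rewrite /invq -/g.
transitivity (\sum_b t * ((b == a)%:R * dot (feat b) g)).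
  rewrite -(sum_enum_val (fun b => t * ((b == a)%:R * dot (feat b) g))).
  by apply: eq_bigr => i _; rewrite !mxE; ring.
rewrite (bigD1 a) //= eqxx mul1r big1 ?addr0 // => b /negPf ->.
by rewrite mul0r mulr0.
Qed.

End Determinant.

End RegularizedOperator.

(** * Information gain *)

Section MaxPairs.
Context {R : realType} {V n : nat}.
Implicit Types (B : arm_sets V n) (f : arm V n -> arm V n -> R).

Lemma max_pairs_ub B f v i j : i \in B v -> j \in B v ->
  f (v, i) (v, j) <= max_pairs B f.
Proof.
move=> Bi Bj; apply: (bigmax_sup v) => //; apply: (bigmax_sup i) => //.
exact: (bigmax_sup j).
Qed.

Lemma max_pairs_le B f (M : R) : 0 <= M ->
  (forall v i j, i \in B v -> j \in B v -> f (v, i) (v, j) <= M) ->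
  max_pairs B f <= M.
Proof.
move=> M0 fM; apply: bigmax_le => // v _; apply: bigmax_le => // i Bi.
by apply: bigmax_le => // j Bj; exact: fM.
Qed.

Lemma max_pairs_ge0 B f : 0 <= max_pairs B f.
Proof. exact: bigmax_ge_id. Qed.

End MaxPairs.

Section LogBounds.
Context {R : realType}.
Implicit Types x : R.

Lemma ln1D_ge x : 0 <= x -> x / (1 + x) <= ln (1 + x).
Proof.
move=> x0; have x1 : 0 < 1 + x by lra.
have : ln (1 + (- x / (1 + x))) <= - x / (1 + x).
  apply: le_ln1Dx; rewrite ltr_pdivlMr //; lra.
have -> : 1 + - x / (1 + x) = (1 + x)^-1 by field; rewrite gt_eqF.
by rewrite lnV // mulNr lerN2.
Qed.

Lemma ln_nat_ge0 (m : nat) : 0 <= ln m%:R :> R.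
Proof. by case: m => [|m]; [rewrite ln0|rewrite ln_ge0 // ler1n]. Qed.

Lemma ln_prod1D (s : seq R) : {in s, forall x, 0 <= x} ->
  ln (\prod_(x <- s) (1 + x)) = \sum_(x <- s) ln (1 + x).
Proof.
elim: s => [|x s IHs] s0; first by rewrite !big_nil ln1.
have x0 : 0 < 1 + x by rewrite ltr_pwDl // s0 // mem_head.
rewrite !big_cons lnM ?IHs ?posrE //.
  by move=> y ys; rewrite s0 // in_cons ys orbT.
rewrite big_seq; apply: prodr_gt0 => y ys.
by rewrite ltr_pwDl // s0 // in_cons ys orbT.
Qed.

(** With x the eigenvalues of K / xi, the right-hand side is the determinant after scaling the
    weights by 1 - t, and the sum of x / (1 + x) is the logarithmic derivative. The inequality is
    exact to first order in t. *)
Lemma bernoulli_prod (t : R) (s : seq R) : 0 <= t <= 1 -> {in s, forall x, 0 <= x} ->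
  (1 - t * \sum_(x <- s) x / (1 + x)) * \prod_(x <- s) (1 + x)
  <= \prod_(x <- s) (1 + (1 - t) * x).
Proof.
move=> /andP [t0 t1]; elim: s => [|x s IHs] s0.
  by rewrite !big_nil mulr0 subr0 mulr1.
have x0 : 0 <= x by rewrite s0 // mem_head.
have {}s0 : {in s, forall x, 0 <= x}.
  by move=> y ys; rewrite s0 // in_cons ys orbT.
rewrite !big_cons; have {IHs} := IHs s0.
set T := \sum_(y <- s) _; set p := \prod_(y <- s) _; set p' := \prod_(y <- s) _.
move=> h; have x1 : 1 + x != 0 by rewrite gt_eqF // ltr_pwDl.
have T0 : 0 <= T.
  by rewrite /T big_seq sumr_ge0 // => y /s0 y0; rewrite divr_ge0 // addr_ge0.
have p0 : 0 <= p.
  by rewrite /p big_seq prodr_ge0 // => y /s0 y0; rewrite addr_ge0.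
have : (1 + (1 - t) * x) * ((1 - t * T) * p) <= (1 + (1 - t) * x) * p'.
  by rewrite ler_wpM2l // addr_ge0 // mulr_ge0 // subr_ge0.
apply: le_trans; rewrite -subr_ge0.
have -> : (1 + (1 - t) * x) * ((1 - t * T) * p) -
    (1 - t * (x / (1 + x) + T)) * ((1 + x) * p) = t ^+ 2 * x * T * p.
  by field.
by rewrite !mulr_ge0 // sqr_ge0.
Qed.

End LogBounds.

Section Spectrum.
Context {R : realType} {m : nat}.
Variables (K : 'M[R]_m) (alpha : seq R).
Hypothesis Ka : char_poly K = \prod_(a <- alpha) ('X - a%:P).

Lemma size_spectrum : size alpha = m.
Proof. by have := size_char_poly K; rewrite Ka size_prod_XsubC => -[]. Qed.

Lemma trace_spectrum : \tr K = \sum_(a <- alpha) a.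
Proof.
have sm := size_spectrum; case: (posnP m) => [m0|m0].
  have -> : alpha = [::] by apply: size0nil; rewrite sm.
  by rewrite big_nil /mxtrace big1 // => i; have := leq_trans (ltn_ord i) (eq_leq m0).
have := char_poly_trace K m0; rewrite Ka -[m in m.-1]sm coefPn_prod_XsubC.
  by move=> /oppr_inj.
by rewrite sm -lt0n.
Qed.

End Spectrum.

Section InformationGain.
Context {R : realType} {H : lmodType R} {V n : nat}.
Variables (dot : {dot H for idfun}) (feat : arm V n -> H) (xi : R).
Hypothesis xi0 : 0 < xi.
Local Notation gram := (gram dot feat).
Local Notation invq := (invq dot feat).

Lemma xiV_ge0 : 0 <= xi^-1. Proof. by rewrite invr_ge0 ltW. Qed.

Lemma mxtrace_weighted_gram (w : arm V n -> R) : (forall a, 0 <= w a) ->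
  \tr (weighted_gram gram w) = \sum_a w a * dot (feat a) (feat a).
Proof.
move=> w0; rewrite /mxtrace -(sum_enum_val (fun a => w a * dot (feat a) (feat a))).
by apply: eq_bigr => i _; rewrite weighted_gramE // -expr2 sqr_sqrtr.
Qed.

Lemma det_info_ge1 (w : arm V n -> R) : (forall a, 0 <= w a) ->
  1 <= \det (1%:M + xi^-1 *: weighted_gram gram w).
Proof.
move=> w0; apply: det_1psd_ge1; first by rewrite linearZ /= trmx_weighted_gram.
by apply: psdZ; [exact: xiV_ge0|exact: psd_weighted_gram].
Qed.

(** By [dot_le_invq] the hypothesis on [y] forces the trace to be at least xi, so the determinant is
    at least 2, and ln 2 >= 1/2. *)
Lemma info_gain_ge_half (l : {ffun arm V n -> R}) (y : H) :
  (forall a, 0 <= l a) -> 0 < dot y y -> 2 * xi * invq xi l y <= dot y y ->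
  2^-1 <= info_gain gram xi l.
Proof.
move=> l0 y0 yQ.
have q0 : 0 <= invq xi l y by exact: invq_ge0.
have := @dot_le_invq _ _ _ _ dot feat _ _ xi0 l0 y.
rewrite -mxtrace_weighted_gram //; set tr := \tr _ => yT.
have trx : 1 <= xi^-1 * tr.
  rewrite mulrC ler_pdivlMr // mul1r leNgt; apply/negP => trx.
  have qp : 0 < invq xi l y.
    rewrite lt_def q0 andbT; apply: contraTneq yT => ->.
    by rewrite mulr0 -ltNge.
  have : (xi + tr) * invq xi l y < 2 * xi * invq xi l y by rewrite ltr_pM2r //; lra.
  by rewrite ltNge (le_trans yQ).
have : 1 + xi^-1 * tr <= \det (1%:M + xi^-1 *: weighted_gram gram l).
  rewrite /tr -mxtraceZ; apply: det_1psd.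
    by rewrite linearZ /= trmx_weighted_gram.
  by apply: psdZ; [exact: xiV_ge0|exact: psd_weighted_gram].
move=> hdet; apply: (@le_trans _ _ (ln (1 + 1))).
  by have := @ln1D_ge R 1 ler01; rewrite div1r.
by rewrite /info_gain ler_ln ?posrE //; lra.
Qed.

(** Eigenvectors of the covariance operator become eigenvectors of the Gram matrix with the same
    eigenvalues; each one above xi contributes a factor 1 + mu / xi >= 2 to the determinant. *)
Lemma dtilde_info_gain (l : {ffun arm V n -> R}) : (forall a, 0 <= l a) ->
  (dtilde dot feat xi l)%:R * ln 2 <= info_gain gram xi l.
Proof.
move=> l0; rewrite /dtilde.
elim/big_ind: _ => [|x y hx hy|r /asboolP [h [mu [hh hmu]]]].
- by rewrite mul0r ln_ge0 // det_info_ge1.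
- by rewrite /maxn; case: ifP.
have mu0 i : 0 < mu i by have [_] := hmu i; apply: lt_trans.
pose K := weighted_gram gram l.
(* Images of the [h i] under the weighted feature map; the division by the square root of [mu i]
   makes the rows orthonormal. *)
pose U : 'M[R]_(r, #|{: arm V n}|) := \matrix_(i, j)
  (Num.sqrt (l (enum_val j)) * dot (feat (enum_val j)) (h i) / Num.sqrt (mu i)).
pose D : 'rV[R]_r := \row_i mu i.
have covE i g : \sum_a l a * (dot (feat a) (h i) * dot (feat a) g) = mu i * dot (h i) g.
  rewrite -dotZl -(proj1 (hmu i)) /cov_op dot_suml; apply: eq_bigr => a _.
  by rewrite dotZl /rank1 dotZl.
have sl (j : 'I_#|{: arm V n}|) :
    Num.sqrt (l (enum_val j)) * Num.sqrt (l (enum_val j)) = l (enum_val j).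
  by rewrite -expr2 sqr_sqrtr.
have smu0 i : Num.sqrt (mu i) != 0 by rewrite gt_eqF // sqrtr_gt0.
have UU : U *m U^T = 1%:M.
  apply/matrixP => i i'; rewrite !mxE.
  transitivity ((Num.sqrt (mu i) * Num.sqrt (mu i'))^-1 *
      \sum_a l a * (dot (feat a) (h i) * dot (feat a) (h i'))).
    rewrite -(sum_enum_val (fun a => l a * (dot (feat a) (h i) * dot (feat a) (h i')))).
    rewrite mulr_sumr; apply: eq_bigr => j _; rewrite !mxE -[in RHS]sl.
    by field; rewrite !smu0.
  rewrite covE hh; have [->|] := eqVneq i i'; last by rewrite !mulr0.
  by rewrite mulr1 -expr2 sqr_sqrtr ?mulVf ?gt_eqF // ltW.
have UK : U *m K = diag_mx D *m U.
  apply/matrixP => i j; rewrite mul_diag_mx !mxE.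
  transitivity (Num.sqrt (l (enum_val j)) / Num.sqrt (mu i) *
      \sum_a l a * (dot (feat a) (h i) * dot (feat a) (feat (enum_val j)))).
    rewrite -(sum_enum_val (fun a => l a *
      (dot (feat a) (h i) * dot (feat a) (feat (enum_val j))))).
    rewrite mulr_sumr; apply: eq_bigr => j' _; rewrite weighted_gramE // !mxE.
    by rewrite -[in RHS](sl j'); field.
  by rewrite covE (dotC dot (h i)); field.
have := @det_1scale_eigenvectors _ _ _ K U D xi^-1 xiV_ge0
  (trmx_weighted_gram _ _ _) (psd_weighted_gram _ _ l0) UU UK.
move=> /(_ _) hdet.
have {}hdet : 2 ^+ r <= \det (1%:M + xi^-1 *: K).
  apply: le_trans (hdet _); last by move=> i; rewrite mxE ltW.
  rewrite -[r in 2 ^+ r]card_ord -prodr_const; apply: ler_prod => i _.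
  rewrite mxE ler0n /= -[2]/(1 + 1) lerD2l mulrC ler_pdivlMr // mul1r ltW //.
  by case: (hmu i).
rewrite mulr_natl -lnXn // /info_gain ler_ln ?posrE // ?exprn_gt0 //.
exact: lt_le_trans hdet.
Qed.

Section Maximizer.
Variables (l : {ffun arm V n -> R}) (alpha : seq R).
Hypotheses (sl : simplex l)
  (lmax : forall l', simplex l' -> info_gain gram xi l' <= info_gain gram xi l)
  (Ka : is_spectrum (weighted_gram gram l) alpha).
Let l0 : forall a, 0 <= l a := proj1 sl.

Lemma max_info_gainE : max_info_gain gram xi = info_gain gram xi l.
Proof.
apply/eqP; rewrite eq_le; apply/andP; split.
  by apply: ge_sup; [exists (info_gain gram xi l), l|move=> _ [l' sl' <-]; exact: lmax].
apply: ub_le_sup; last by exists l.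
by exists (info_gain gram xi l) => _ [l' sl' <-]; exact: lmax.
Qed.

Lemma alpha_ge0 : {in alpha, forall a, 0 <= a}.
Proof. by case: Ka => _ /psd_spectrum_ge0; apply; exact: psd_weighted_gram. Qed.

Lemma scaled_alpha_ge0 : {in [seq a / xi | a <- alpha], forall x, 0 <= x}.
Proof. by move=> _ /mapP [a /alpha_ge0 a0 ->]; rewrite divr_ge0 // ltW. Qed.

Lemma det_gram_spectrum c : \det (1%:M + (xi^-1 * c) *: weighted_gram gram l)
  = \prod_(x <- [seq a / xi | a <- alpha]) (1 + c * x).
Proof.
rewrite (det_1scale_spectrum _ (proj2 Ka)) big_map.
by apply: eq_bigr => a _; congr (1 + _); ring.
Qed.

Lemma info_gain_spectrum :
  info_gain gram xi l = \sum_(a <- alpha) ln (1 + a / xi).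
Proof.
rewrite /info_gain -[xi^-1 in LHS]mulr1 det_gram_spectrum.
under eq_bigr do rewrite mul1r.
by rewrite ln_prod1D ?big_map //; exact: scaled_alpha_ge0.
Qed.

(* First-order optimality of [l], read off the exact value of the determinant
   along the segment from [l] to the point mass at [a]. *)
Lemma invq_le_info_gain a : invq xi l (feat a) <= info_gain gram xi l.
Proof.
set s := [seq a / xi | a <- alpha]; set T := \sum_(x <- s) x / (1 + x).
have s0 := scaled_alpha_ge0; set q := invq xi l (feat a).
have q0 : 0 <= q by exact: invq_ge0.
apply: (@le_trans _ _ T); last first.
  rewrite info_gain_spectrum /T big_map big_seq [leRHS]big_seq; apply: ler_sum => x xa.
  by apply: ln1D_ge; rewrite divr_ge0 ?(ltW xi0) // alpha_ge0.
have T0 : 0 <= T.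
  by rewrite /T big_seq sumr_ge0 // => x /s0 x0; rewrite divr_ge0 // addr_ge0.
(* Maximality on the segment gives (1 - t T) (1 + t q) <= 1; dividing by t leaves a remainder of
   order t. *)
have main t : 0 < t <= 1 -> q <= T + t * (q * T).
  move=> /andP [t0 t1]; have t1' : 0 <= 1 - t by rewrite subr_ge0.
  pose w b := (1 - t) * l b.
  have w0 b : 0 <= w b by rewrite mulr_ge0.
  pose l' := [ffun b => w b + t * (b == a)%:R] : {ffun arm V n -> R}.
  have sl' : simplex l'.
    split => [b|]; first by rewrite ffunE addr_ge0 // mulr_ge0 ?(ltW t0).
    under eq_bigr do rewrite ffunE.
    rewrite big_split -mulr_sumr (proj2 sl) (bigD1 a) //= eqxx big1 ?addr0.
      by rewrite !mulr1 subrK.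
    by move=> b /negPf ->; rewrite mulr0.
  have := lmax sl'; rewrite /info_gain ler_ln ?posrE; last 2 first.
  - by apply: lt_le_trans (det_info_ge1 _) => // b; exact: (proj1 sl').
  - exact: lt_le_trans (det_info_ge1 l0).
  have -> : weighted_gram gram l' = weighted_gram gram (fun b => w b + t * (b == a)%:R).
    by apply/matrixP => i j; rewrite !mxE !ffunE.
  rewrite det_1gram_add ?(ltW t0) //.
  have -> : weighted_gram gram w = (1 - t) *: weighted_gram gram l.
    apply/matrixP => i j; rewrite !mxE /w mulrACA sqrtrM ?mulr_ge0 //.
    by rewrite -expr2 sqrtr_sqr ger0_norm // mulrA.
  rewrite scalerA det_gram_spectrum -[X in X *: _]mulr1 det_gram_spectrum.
  under [in leRHS]eq_bigr do rewrite mul1r.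
  rewrite -/s; set p := \prod_(x <- s) (1 + x).
  have p0 : 0 < p.
    by rewrite /p big_seq prodr_gt0 // => x /s0 x0; rewrite ltr_pwDl.
  (* Shrinking the weights can only increase the form, so q may replace its value at [w]. *)
  have qq : q <= invq xi w (feat a).
    apply: invq_anti => // b; rewrite w0 /w -[leRHS]mul1r ler_wpM2r //.
    by rewrite lerBlDr lerDl ltW.
  have tt : 0 <= t <= 1 by rewrite (ltW t0).
  have B := bernoulli_prod tt s0; rewrite -/T -/p in B.
  move=> C.
  have : (1 - t * T) * p * (1 + t * q) <= p.
    apply: le_trans C; apply: (@le_trans _ _ (\prod_(x <- s) (1 + (1 - t) * x) * (1 + t * q))).
      by rewrite ler_wpM2r // addr_ge0 // mulr_ge0 // ltW.
    rewrite ler_wpM2l ?lerD2l ?ler_pM2l //.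
    by rewrite big_seq prodr_ge0 // => x /s0 x0; rewrite addr_ge0 // mulr_ge0.
  rewrite mulrAC -[leRHS]mul1r ler_pM2r // => E.
  have : t * q <= t * (T + t * (q * T)) by lra.
  by rewrite ler_pM2l.
(* The limit t -> 0: t = e / (1 + q T) makes the remainder at most e, and t = 1 serves when this
   value exceeds 1. *)
apply/ler_addgt0Pr => e e0.
have k0 : 0 < 1 + q * T by rewrite ltr_pwDl // mulr_ge0.
have [ee|ee] := leP (e / (1 + q * T)) 1.
  apply: le_trans (main (e / (1 + q * T)) _) _; first by rewrite divr_gt0.
  rewrite lerD2l mulrAC ler_pdivrMr // ler_wpM2l ?(ltW e0) //; lra.
apply: le_trans (main 1 _) _; first by rewrite ltr01 lexx.
rewrite lerD2l mul1r; move: ee; rewrite ltr_pdivlMr // mul1r; lra.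
Qed.

Lemma sq_width_le_info_gain B :
  sq_width dot feat B (reg_op dot feat xi l) <= 4 * info_gain gram xi l.
Proof.
apply: max_pairs_le => [|v i j _ _].
  by rewrite mulr_ge0 // ln_ge0 // det_info_ge1.
have -> y : inv_norm dot (reg_op dot feat xi l) y ^+ 2 = invq xi l y.
  exact: (@sqr_inv_norm _ _ _ _ dot feat _ _ xi0 l0).
apply: le_trans (@invqB _ _ _ _ dot feat _ _ xi0 l0 _ _) _.
have := invq_le_info_gain (v, i); have := invq_le_info_gain (v, j); lra.
Qed.

Lemma alpha_le_trace a : a \in alpha -> a <= \tr (weighted_gram gram l).
Proof.
move=> aa; rewrite (trace_spectrum (proj2 Ka)) (big_rem a) //= lerDl.
rewrite big_seq; apply: sumr_ge0 => b /mem_rem; exact: alpha_ge0.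
Qed.

Lemma ln_alpha_le a : a \in alpha ->
  ln (1 + a / xi) <= ln (1 + \tr (weighted_gram gram l) / xi).
Proof.
move=> aa; have a0 := alpha_ge0 aa; have at_ := alpha_le_trace aa.
rewrite ler_ln ?posrE.
- by rewrite lerD2l ler_pM2r ?invr_gt0.
- by rewrite ltr_pwDl // divr_ge0 // ltW.
- by rewrite ltr_pwDl // divr_ge0 ?(ltW xi0) // (le_trans a0).
Qed.

Lemma trace_ge0 : 0 <= \tr (weighted_gram gram l).
Proof.
by rewrite mxtrace_weighted_gram // sumr_ge0 // => a _; rewrite mulr_ge0 ?dot_ge0.
Qed.

Lemma ln_trace_ge0 : 0 <= ln (1 + \tr (weighted_gram gram l) / xi).
Proof. by rewrite ln_ge0 // lerDl divr_ge0 ?trace_ge0 // ltW. Qed.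

(** Only nonzero eigenvalues contribute to the logarithm, and each is at most the trace. *)
Lemma info_gain_le_rank : info_gain gram xi l <=
  (\rank (weighted_gram gram l))%:R * ln (1 + \tr (weighted_gram gram l) / xi).
Proof.
apply: (@le_trans _ _ ((count (fun a => a != 0) alpha)%:R
    * ln (1 + \tr (weighted_gram gram l) / xi))); last first.
  by rewrite ler_wpM2r ?ln_trace_ge0 // ler_nat count_eigenvalue_neq0 //; case: Ka.
rewrite info_gain_spectrum.
have : {subset alpha <= alpha} by [].
elim: {1 3 4}alpha => [|a s IHs] sub; first by rewrite big_nil mul0r.
rewrite big_cons /= natrD mulrDl lerD //; last first.
  by apply: IHs => b bs; apply: sub; rewrite in_cons bs orbT.
have [->|a0] := eqVneq a 0; first by rewrite mul0r addr0 ln1 mul0r.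
by rewrite mul1r ln_alpha_le // sub // mem_head.
Qed.

(** The first [D] eigenvalues are bounded by the trace; on the tail ln (1 + x) <= x, and the
    inequality defining [D] bounds the sum. *)
Lemma info_gain_le_effective_dim : info_gain gram xi l <=
  (effective_dim V n xi alpha)%:R *
  (ln (1 + \tr (weighted_gram gram l) / xi) + ln (n * V)%:R).
Proof.
have sm : size alpha = (n * V)%N.
  by rewrite (size_spectrum (proj2 Ka)) card_prod !card_ord mulnC.
set D := effective_dim _ _ _ _.
(* At the base value [n * V] the tail is empty, so the inequality holds however the minimum is
   reached. *)
have DP : \sum_(D <= i < n * V) alpha`_i <= D%:R * xi * ln (n * V)%:R.
  rewrite /D /effective_dim; elim/big_ind: _ => //.
    by rewrite big_geq // !mulr_ge0 ?(ltW xi0) ?ln_nat_ge0.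
  by move=> x y hx hy; rewrite /minn; case: ifP.
set Lt := ln (1 + _); have Lt0 : 0 <= Lt by exact: ln_trace_ge0.
have alpha_i i : (i < n * V)%N -> ln (1 + alpha`_i / xi) <= Lt.
  by move=> im; apply: ln_alpha_le; rewrite mem_nth // sm.
have headle k : (k <= n * V)%N -> \sum_(0 <= i < k) ln (1 + alpha`_i / xi) <= k%:R * Lt.
  move=> kD; rewrite -[k in k%:R * _]subn0 mulr_natl -sumr_const_nat.
  rewrite big_nat [leRHS]big_nat; apply: ler_sum => i /andP [_ ik].
  by apply: alpha_i; exact: leq_trans kD.
rewrite info_gain_spectrum (big_nth 0) sm.
have [DV|VD] := leqP D (n * V); last first.
  apply: le_trans (headle _ (leqnn _)) _.
  apply: (@le_trans _ _ (D%:R * Lt)); first by rewrite ler_wpM2r // ler_nat ltnW.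
  by rewrite ler_wpM2l // lerDl ln_nat_ge0.
rewrite (big_cat_nat (leq0n D) DV) /= mulrDr lerD ?headle //.
apply: (@le_trans _ _ (\sum_(D <= i < n * V) alpha`_i / xi)).
  rewrite big_nat [leRHS]big_nat; apply: ler_sum => i /andP [_ ik].
  have a0 : 0 <= alpha`_i / xi.
    by rewrite divr_ge0 ?(ltW xi0) // alpha_ge0 // mem_nth // sm.
  by apply: le_ln1Dx; lra.
by rewrite -mulr_suml ler_pdivrMr // mulrAC.
Qed.

End Maximizer.

End InformationGain.

(** * Independence and sub-Gaussian tails *)

Section Independence.
Context {d : measure_display} {Om : measurableType d} {R : realType}.
Variable P : probability Om R.

(** Independence on rectangles identifies the joint law with the product law, and Tonelli's theorem
    separates the integrals. Nonnegativity avoids integrability conditions. *)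
Lemma expectation_mul_indep d1 d2 (T1 : measurableType d1) (T2 : measurableType d2)
    (X : {mfun Om >-> T1}) (Y : {mfun Om >-> T2}) (f : T1 -> \bar R) (g : T2 -> \bar R) :
  measurable_fun setT f -> measurable_fun setT g ->
  (forall x, 0 <= f x)%E -> (forall y, 0 <= g y)%E ->
  (forall E F, measurable E -> measurable F ->
     P (X @^-1` E `&` Y @^-1` F) = (P (X @^-1` E) * P (Y @^-1` F))%E) ->
  (\int[P]_w (f (X w) * g (Y w)) = \int[P]_w f (X w) * \int[P]_w g (Y w))%E.
Proof.
move=> mf mg f0 g0 XY.
have mXY : measurable_fun [set: Om] (fun w => (X w, Y w)).
  exact: measurable_fun_pair.
pose Z : {mfun Om >-> (T1 * T2)%type} := HB.pack (fun w => (X w, Y w))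
  (isMeasurableFun.Build _ _ _ _ _ mXY).
pose h (z : T1 * T2) : \bar R := (f z.1 * g z.2)%E.
have mh : measurable_fun [set: T1 * T2] h.
  by apply: emeasurable_funM; apply: measurableT_comp.
have h0 z : (0 <= h z)%E by exact: mule_ge0.
have prodE A : measurable A ->
    (distribution P X \x distribution P Y)%E A = distribution P Z A.
  move=> mA; exact: product_measure_unique.
have -> : (\int[P]_w (f (X w) * g (Y w)) = \int[distribution P Z]_z h z)%E.
  by rewrite ge0_integral_pushforward.
rewrite (eq_measure_integral (distribution P X \x distribution P Y)%E); last first.
  by move=> A mA _; exact/esym/prodE.
rewrite fubini_tonelli1 //.
transitivity (\int[distribution P X]_x (f x * \int[P]_w g (Y w)))%E.
  apply: eq_integral => x _; rewrite /fubini_F /h /=.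
  by rewrite ge0_integralZl ?ge0_integral_pushforward.
rewrite ge0_integralZr ?ge0_integral_pushforward //.
exact: integral_ge0.
Qed.

Variables (J : choiceType) (X : J -> {RV P >-> R}).

(** A pi-system generating the sigma-algebra of the variables with index in [Q]; taking [Q] to be a
    set of rounds separates past noise from current noise. *)
Definition cylinders (Q : pred J) : set (set Om) :=
  [set A | exists (s : seq J) (E : J -> set R),
     [/\ uniq s, all Q s, forall j, measurable (E j) &
         A = \big[setI/setT]_(j <- s) (X j @^-1` E j)]].

Lemma cylinders_measurable Q : cylinders Q `<=` measurable.
Proof.
move=> _ [s [E [_ _ mE ->]]]; apply: bigsetI_measurable => j _.
by rewrite -[X in measurable X]setTI; apply: measurable_funP.
Qed.

Lemma cylindersT Q : cylinders Q setT.
Proof. by exists [::], (fun=> setT); split => //; rewrite big_nil. Qed.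

Lemma cylinders1 (Q : pred J) j E : Q j -> measurable E ->
  cylinders Q (X j @^-1` E).
Proof.
by move=> Qj mE; exists [:: j], (fun=> E); split; rewrite //= ?Qj // big_seq1.
Qed.

Lemma cylindersI Q : setI_closed (cylinders Q).
Proof.
move=> _ _ [s1 [E1 [u1 Q1 m1 ->]]] [s2 [E2 [u2 Q2 m2 ->]]].
pose E j := (if j \in s1 then E1 j else setT) `&` (if j \in s2 then E2 j else setT).
exists (undup (s1 ++ s2)), E; split.
- exact: undup_uniq.
- apply/allP => j; rewrite mem_undup mem_cat.
  by case/orP => [/(allP Q1)|/(allP Q2)].
- by move=> j; apply: measurableI; case: ifP.
rewrite -!bigcap_seq; apply/seteqP; split => w /=.
  move=> [h1 h2] j /=; rewrite mem_undup mem_cat /E => js; split.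
    by case: ifP => // j1; exact: h1.
  by case: ifP => // j2; exact: h2.
move=> h; split => j /= js.
  by have [] := h j; rewrite /= ?mem_undup ?mem_cat js // orbT.
by have [] := h j; rewrite /= ?mem_undup ?mem_cat js ?orbT // => _.
Qed.

Lemma sub_cylinders (Q Q' : pred J) : subpred Q Q' ->
  <<s cylinders Q >> `<=` <<s cylinders Q' >>.
Proof.
move=> QQ'; apply: smallest_sub; first exact: smallest_sigma_algebra.
move=> _ [s [E [us Qs mE ->]]]; apply: sub_sigma_algebra.
exists s, E; split => //; apply: sub_all Qs; exact: QQ'.
Qed.

Lemma sigma_cylinders_measurable Q : <<s cylinders Q >> `<=` measurable.
Proof.
apply: smallest_sub; last exact: cylinders_measurable.
exact: sigma_algebra_measurable.
Qed.

Hypothesis indep : mutually_independent X.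

Lemma cylinders_indep (Q Q' : pred J) A B : (forall j, Q j -> ~~ Q' j) ->
  cylinders Q A -> cylinders Q' B -> P (A `&` B) = (P A * P B)%E.
Proof.
move=> QQ' [s1 [E1 [u1 Q1 m1 ->]]] [s2 [E2 [u2 Q2 m2 ->]]].
pose E j := if Q j then E1 j else E2 j.
have e1 : \big[setI/setT]_(j <- s1) (X j @^-1` E1 j)
    = \big[setI/setT]_(j <- s1) (X j @^-1` E j).
  by apply: eq_big_seq => j js; rewrite /E (allP Q1).
have e2 : \big[setI/setT]_(j <- s2) (X j @^-1` E2 j)
    = \big[setI/setT]_(j <- s2) (X j @^-1` E j).
  apply: eq_big_seq => j js; rewrite /E; case: ifPn => // /QQ'.
  by rewrite (allP Q2).
rewrite e1 e2 -big_cat.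
have mE j : measurable (E j) by rewrite /E; case: ifP.
rewrite !indep //; first by rewrite big_cat.
rewrite cat_uniq u1 u2 andbT /=; apply/hasPn => j js2.
by apply/negP => js1; have := QQ' _ (allP Q1 _ js1); rewrite (allP Q2).
Qed.

(** With [B] fixed, both sides are finite measures in [A]; they agree on a pi-system, hence on the
    sigma-algebra that it generates. *)
Lemma pi_lambda_indep (G : set (set Om)) (B : set Om) : G `<=` measurable ->
  setI_closed G -> G setT -> measurable B ->
  (forall A, G A -> P (A `&` B) = (P A * P B)%E) ->
  forall A, <<s G >> A -> P (A `&` B) = (P A * P B)%E.
Proof.
move=> Gm GI GT mB GB A sA.
have p0 : 0 <= fine (P B) by rewrite fine_ge0.
pose m1 := mrestr P mB.
pose m2 := mscale (NngNum p0) P.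
have -> : (P A * P B)%E = m2 A.
  by rewrite /m2 /mscale /= fineK ?fin_num_measure // muleC.
apply: (g_sigma_algebra_measure_unique G Gm (fun=> setT) _ _ m1 m2) => //.
- by rewrite bigcup_const //; exists 0%N.
- move=> C GC; change (P (C `&` B) = mscale (NngNum p0) P C).
  by rewrite /mscale /= fineK ?fin_num_measure // muleC GB.
- move=> _; change (P (setT `&` B) < +oo)%E.
  by rewrite setTI (le_lt_trans (probability_le1 _ mB)) // ltry.
Qed.

Lemma sigma_cylinders_indep (Q Q' : pred J) A B : (forall j, Q j -> ~~ Q' j) ->
  <<s cylinders Q >> A -> <<s cylinders Q' >> B -> P (A `&` B) = (P A * P B)%E.
Proof.
move=> QQ' sA sB; apply: (@pi_lambda_indep (cylinders Q)) => //.
- exact: cylinders_measurable.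
- exact: cylindersI.
- exact: cylindersT.
- exact: sigma_cylinders_measurable sB.
move=> {sA} {}A cA; rewrite setIC muleC.
apply: (@pi_lambda_indep (cylinders Q')) => //.
- exact: cylinders_measurable.
- exact: cylindersI.
- exact: cylindersT.
- exact: cylinders_measurable cA.
move=> C cC; rewrite setIC muleC; exact: (cylinders_indep QQ').
Qed.

(** Retyping the domain with the generated sigma-algebra makes the usual closure rules for
    measurable functions available for the sub-sigma-algebra. *)
Definition cyl_measurable (Q : pred J) (f : Om -> R) :=
  measurable_fun [set: g_sigma_algebraType (cylinders Q)]
    (f : g_sigma_algebraType (cylinders Q) -> R).

Lemma cyl_measurableP Q f E : cyl_measurable Q f -> measurable E ->
  <<s cylinders Q >> (f @^-1` E).
Proof. by move=> mf mE; have := mf measurableT E mE; rewrite setTI. Qed.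

Lemma cyl_measurable1 (Q : pred J) j : Q j -> cyl_measurable Q (X j).
Proof.
move=> Qj _ E mE; rewrite setTI; apply: sub_sigma_algebra.
exact: cylinders1.
Qed.

Lemma cyl_measurable_exp (Q : pred J) (c : J -> R) j : Q j ->
  cyl_measurable Q (fun w => expR (c j * X j w)).
Proof.
move=> Qj; apply: measurableT_comp => //; apply: measurable_funM => //.
exact: cyl_measurable1.
Qed.

Lemma expectation_prod_exp (c : J -> R) (s : seq J) : uniq s ->
  (\int[P]_w (\prod_(j <- s) expR (c j * X j w))%:E
   = \prod_(j <- s) \int[P]_w (expR (c j * X j w))%:E)%E.
Proof.
elim: s => [_|j s IHs /= /andP [js us]].
  under eq_integral do rewrite big_nil.
  by rewrite big_nil integral_cst // mul1e; exact: (probability_setT P).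
rewrite big_cons -IHs //.
have mexp i : measurable_fun [set: Om] (fun w => expR (c i * X i w)).
  by apply: measurableT_comp => //; apply: measurable_funM.
have mprod : measurable_fun [set: Om] (fun w => \prod_(i <- s) expR (c i * X i w)).
  by apply: measurable_prod => i _; exact: mexp.
pose Y : {RV P >-> R} := HB.pack (fun w => expR (c j * X j w))
  (isMeasurableFun.Build _ _ _ _ _ (mexp j)).
pose Z : {RV P >-> R} := HB.pack (fun w => \prod_(i <- s) expR (c i * X i w))
  (isMeasurableFun.Build _ _ _ _ _ mprod).
(* [expectation_mul_indep] asks for test functions nonnegative on the whole line; the absolute value
   is one, and it is the identity on the values of [Y] and [Z]. *)
have mnorm : measurable_fun [set: R] (fun x : R => `|x|%:E).
  by apply/measurable_EFinP; exact: normr_measurable.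
have Y0 w : 0 <= Y w by exact: expR_ge0.
have Z0 w : 0 <= Z w by apply: prodr_ge0 => i _; exact: expR_ge0.
transitivity (\int[P]_w (`|Y w|%:E * `|Z w|%:E))%E.
  by apply: eq_integral => w _; rewrite big_cons -EFinM !ger0_norm.
rewrite (@expectation_mul_indep _ _ _ _ Y Z _ _ mnorm mnorm).
- by congr (_ * _)%E; apply: eq_integral => w _; rewrite ger0_norm.
- by move=> x; rewrite lee_fin.
- by move=> x; rewrite lee_fin.
move=> E F mE mF; apply: (@sigma_cylinders_indep (pred1 j) (mem s)).
- by move=> i /eqP ->.
- by apply: cyl_measurableP => //; apply: cyl_measurable_exp; rewrite /= eqxx.
- apply: cyl_measurableP => //; apply: measurable_prod => i si.
  exact: cyl_measurable_exp.
Qed.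

Hypothesis sg : forall j, one_subgaussian (X j).

Lemma subgaussian_tail (c : J -> R) (s : seq J) (v t : R) : uniq s ->
  0 < v -> 0 < t -> \sum_(j <- s) c j ^+ 2 <= v ->
  (P [set w | (t <= \sum_(j <- s) c j * X j w)%R]
   <= (expR (- (t ^+ 2 / (2 * v))))%:E)%E.
Proof.
(* This r minimizes the Chernoff exponent r^2 v / 2 - r t. *)
move=> us v0 t0 cv; pose r := t / v.
have r0 : 0 < r by rewrite divr_gt0.
have mS : measurable_fun [set: Om] (fun w => \sum_(j <- s) c j * X j w).
  by apply: measurable_sum => j; apply: measurable_funM.
pose S : {RV P >-> R} := HB.pack (fun w => \sum_(j <- s) c j * X j w)
  (isMeasurableFun.Build _ _ _ _ _ mS).
apply: le_trans (chernoff S t r0) _.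
have : ('M_P S r <= (expR (r ^+ 2 * v / 2))%:E)%E.
  rewrite /mmt_gen_fun unlock.
  have -> : (\int[P]_w ((expR \o r \o* S) w)%:E
      = \int[P]_w (\prod_(j <- s) expR (r * c j * X j w))%:E)%E.
    apply: eq_integral => w _; rewrite /= -expR_sum mulr_suml; congr (expR _)%:E.
    by apply: eq_bigr => j _; ring.
  rewrite (@expectation_prod_exp (fun j => r * c j)) //.
  apply: (@le_trans _ _ (\prod_(j <- s) (expR ((r * c j) ^+ 2 / 2))%:E)%E).
    elim: (s) => [|j s' IHs]; first by rewrite !big_nil.
    rewrite !big_cons; apply: lee_pmul => //.
    - by apply: integral_ge0 => w _; rewrite lee_fin expR_ge0.
    - elim/big_ind: _ => // [x y|i _]; first exact: mule_ge0.
      by apply: integral_ge0 => w _; rewrite lee_fin expR_ge0.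
    - have := sg j (r * c j); rewrite /mmt_gen_fun unlock.
      congr (_ <= _)%E; apply: eq_integral => w _ /=.
      by rewrite [X j w * _]mulrC.
  rewrite prodEFin -expR_sum lee_fin ler_expR.
  rewrite -mulr_suml ler_pM2r ?invr_gt0 // (eq_bigr (fun j => r ^+ 2 * c j ^+ 2)).
    by rewrite -mulr_sumr ler_wpM2l ?sqr_ge0.
  by move=> j _; rewrite exprMn.
move=> h; apply: le_trans (lee_wpmul2r _ h) _; first by rewrite lee_fin expR_ge0.
rewrite -EFinM -expRD lee_fin ler_expR le_eqVlt; apply/orP; left; apply/eqP.
by rewrite /r; field; rewrite gt_eqF.
Qed.

End Independence.

(** * Finite-valued random elements and the union bound *)

Section FiniteValued.
Context {d : measure_display} {Om : measurableType d}.

(** Measurability of all fibers, for values such as candidate sets. The sigma-algebra on [Om] is a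
    parameter, so the same notion also expresses dependence on past noise only. *)
Definition fin_measurable (T : finType) (f : Om -> T) :=
  forall t, measurable [set w | f w = t].

Lemma fin_measurable_set (T : finType) (f : Om -> T) (A : set T) :
  fin_measurable f -> measurable [set w | A (f w)].
Proof.
move=> mf; have -> : [set w | A (f w)] = \bigcup_(t in A) [set w | f w = t].
  by apply/seteqP; split => [w Aw|w [t At /= ->]] //; exists (f w).
by apply: fin_bigcup_measurable => // t _; exact: mf.
Qed.

Lemma fin_measurable_comp (T U : finType) (g : T -> U) (f : Om -> T) :
  fin_measurable f -> fin_measurable (fun w => g (f w)).
Proof. by move=> mf u; exact: (fin_measurable_set [set t | g t = u]). Qed.

Lemma fin_measurable_pair (T U : finType) (f : Om -> T) (g : Om -> U) :
  fin_measurable f -> fin_measurable g -> fin_measurable (fun w => (f w, g w)).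
Proof.
move=> mf mg [t u].
have -> : [set w | (f w, g w) = (t, u)] = [set w | f w = t] `&` [set w | g w = u].
  by apply/seteqP; split => w /=; [case=> -> ->|case=> -> ->].
exact: measurableI.
Qed.

Lemma fin_measurable_ffun (I T : finType) (f : I -> Om -> T) :
  (forall i, fin_measurable (f i)) -> fin_measurable (fun w => [ffun i => f i w]).
Proof.
move=> mf h; have -> : [set w | [ffun i => f i w] = h]
    = \bigcap_(i in [set: I]) [set w | f i w = h i].
  apply/seteqP; split => w /= hw.
    by move=> i _ /=; rewrite -hw ffunE.
  by apply/ffunP => i; rewrite ffunE hw.
by apply: fin_bigcap_measurable => // i _; exact: mf.
Qed.

Lemma fin_measurable_cst (T : finType) (t : T) : fin_measurable (fun=> t).
Proof.
move=> u; have [->|tu] := eqVneq t u.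
  by rewrite (_ : [set _ | _] = setT) //; apply/seteqP.
by rewrite (_ : [set _ | _] = set0) //; apply/seteqP; split => // w /= /eqP; rewrite (negPf tu).
Qed.

Lemma fin_measurable_le (R : realType) (c : R) (f : Om -> R) :
  measurable_fun setT f -> fin_measurable (fun w => c <= f w).
Proof.
move=> mf; have mc : measurable [set w | c <= f w].
  rewrite -[X in measurable X]setTI.
  rewrite (_ : [set w | c <= f w] = f @^-1` `[c, +oo[); first exact: mf.
  by apply/seteqP; split => w /=; rewrite in_itv /= andbT.
case; first exact: mc.
have -> : [set w | (c <= f w) = false] = ~` [set w | c <= f w].
  by apply/seteqP; split => w /=; [move=> ->|move/negP/negbTE].
exact: measurableC.
Qed.

Context {R : realType} (P : probability Om R).

Lemma fsum_setT (I : finType) (f : I -> \bar R) :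
  (\sum_(i \in [set: I]) f i = \sum_i f i)%E.
Proof.
rewrite (fsbigE (index_enum I)) ?index_enum_uniq //; last first.
  by move=> i _; rewrite mem_index_enum.
by under eq_bigl do rewrite in_setT.
Qed.

Lemma union_bound (I : finType) (A : set Om) (F : I -> set Om) :
  measurable A -> (forall i, measurable (F i)) -> A `<=` \bigcup_i F i ->
  (P A <= \sum_i P (F i))%E.
Proof.
move=> mA mF AF; have := @content_sub_fsum _ _ _ P I setT A F finite_finset.
by rewrite fsum_setT; apply.
Qed.

Lemma sum_probability_fibers (T : finType) (f : Om -> T) : fin_measurable f ->
  (\sum_t P [set w | f w = t] = 1)%E.
Proof.
move=> mf; rewrite -(probability_setT P).
have -> : [set: Om] = \bigcup_(t in [set: T]) [set w | f w = t].
  by apply/seteqP; split => // w _; exists (f w).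
rewrite measure_fin_bigcup ?fsum_setT //; first exact: finite_finset.
by move=> t u _ _ [w [/= <- <-]].
Qed.

End FiniteValued.

(** * One run of the algorithm *)

Section Algorithm.
Context {R : realType} {H : lmodType R} {V n : nat} {Om : Type}.
Variables (dot : {dot H for idfun}) (feat : arm V n -> H) (theta : H).
Variable eta : nat * arm V n * nat -> Om -> R.
Variables (delta xi : R) (lam : arm_sets V n -> {ffun arm V n -> R}).
Variable tau : R -> {ffun arm V n -> R} -> R -> nat.
Variable ROUND : R -> {ffun arm V n -> R} -> forall N : nat, R -> N.-tuple (arm V n).

Implicit Types (B : arm_sets V n)  (v : 'I_V).
Local Notation eps := (10^-1).
Local Notation F := (fun a => dot (feat a) theta).
Local Notation budget := (budget dot feat xi delta eps lam tau).
Local Notation pulls := (pulls dot feat xi delta eps lam tau ROUND).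
Local Notation rho := (rho dot feat xi lam).
Local Notation gap_estimate := (gap_estimate dot feat (gram dot feat) F
  (fun r a j => eta (r, a, j)) xi delta eps lam tau ROUND).
Local Notation eliminate := (eliminate dot feat (gram dot feat) F
  (fun r a j => eta (r, a, j)) xi delta eps lam tau ROUND).

Definition pull_weight r B a : R := (pulls r B a)%:R.

Definition dual r B (y : H) : H :=
  op_inv (regop dot feat ((budget r B)%:R * xi) (pull_weight r B)) y.

Definition samples r B : seq (nat * arm V n * nat) :=
  [seq (r, a, j) | a <- enum {: arm V n}, j <- iota 0 (pulls r B a)].

(** For fixed [B] the pull counts and [dual] are deterministic, so this is a linear form with
    constant coefficients in the samples of round r. *)
Definition noise r B (y : H) (w : Om) : R :=
  \sum_(t <- samples r B) dot (dual r B y) (feat t.1.2) * eta t w.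

Lemma uniq_samples r B : uniq (samples r B).
Proof.
apply: allpairs_uniq_dep; first exact: enum_uniq.
  by move=> a _; exact: iota_uniq.
by move=> [a j] [a' j'] _ _ /= [-> ->].
Qed.

Lemma sum_samples r B (f : nat * arm V n * nat -> R) :
  \sum_(t <- samples r B) f t = \sum_a \sum_(j < pulls r B a) f (r, a, j : nat).
Proof.
rewrite /samples big_allpairs_dep big_enum; apply: eq_bigr => a _.
by rewrite -(big_mkord xpredT (fun j => f (r, a, j))) /index_iota subn0.
Qed.

Lemma sum_count_mem (M : lmodType R) (s : seq (arm V n)) (f : arm V n -> M) :
  \sum_(a <- s) f a = \sum_a (count_mem a s)%:R *: f a.
Proof.
elim: s => [|a s IHs].
  by rewrite big_nil big1 // => a _; rewrite scale0r.
rewrite big_cons IHs /= [in RHS](eq_bigr (fun b =>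
  (a == b)%:R *: f b + (count_mem b s)%:R *: f b)); last first.
  by move=> b _; rewrite natrD scalerDl.
rewrite big_split /=; congr (_ + _).
rewrite (bigD1 a) //= eqxx scale1r big1 ?addr0 // => b.
by rewrite eq_sym => /negPf ->; rewrite scale0r.
Qed.

Lemma sampled_opE r B :
  sampled_op dot feat xi (allocation dot feat xi delta eps lam tau ROUND r B)
  = regop dot feat ((budget r B)%:R * xi) (pull_weight r B).
Proof.
apply/funext => g; rewrite /sampled_op /regop; congr (_ + _).
by rewrite -(big_tuple _ _ _ xpredT (fun a => rank1 dot (feat a) g)) sum_count_mem.
Qed.

Lemma pulls_budget0 r B a : budget r B = 0%N -> pulls r B a = 0%N.
Proof.
move=> N0; apply/eqP; rewrite -leqn0 -[leqRHS]N0.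
by rewrite -[leqRHS](size_tuple (allocation dot feat xi delta eps lam tau ROUND r B)) count_size.
Qed.

Lemma gap_estimateN r B w a b : gap_estimate r B w b a = - gap_estimate r B w a b.
Proof.
rewrite /Defs.gap_estimate -opprB [(- _)^T]linearN /= !mulNmx mxE //.
Qed.

(** A zero budget leaves the zero matrix to invert, but then there are no outcomes, and the formula
    still yields 0. *)
Lemma gap_estimate_budget0 r B w a b : budget r B = 0%N -> gap_estimate r B w a b = 0.
Proof.
move=> N0; rewrite /Defs.gap_estimate.
set o := outcome_col _ _ _ _ _ _ _ _ _ _ _ _ _; suff -> : o = 0 by rewrite mulmx0 mxE.
by apply/colP => i; rewrite !mxE pulls_budget0 // sqrtr0 mul0r.
Qed.

Hypothesis xi0 : 0 < xi.

Lemma pull_weight_ge0 r B a : 0 <= pull_weight r B a.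
Proof. exact: ler0n. Qed.

Lemma gap_estimate_decomposition r B w a b : (0 < budget r B)%N ->
  gap_estimate r B w a b = dot (feat a - feat b) theta
    - (budget r B)%:R * xi * dot (dual r B (feat a - feat b)) theta
    + noise r B (feat a - feat b) w.
Proof.
move=> N0; have c0 : 0 < (budget r B)%:R * xi by rewrite mulr_gt0 // ltr0n.
set y := feat a - feat b.
(* Average noise on an arm; for an unsampled arm the quotient is 0, which is harmless as its weight
   is 0 too. *)
pose e c := (\sum_(j < pulls r B c) eta (r, c, j : nat) w) / (pulls r B c)%:R.
have we c : pull_weight r B c * e c = \sum_(j < pulls r B c) eta (r, c, j : nat) w.
  rewrite /pull_weight /e; have [->|p0] := posnP (pulls r B c).
    by rewrite big_ord0 !mul0r.
  by rewrite mulrC divfK // pnatr_eq0 -lt0n.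
have := kernel_trick dot feat c0 (pull_weight_ge0 r B) y
  (mean_outcome dot feat F (fun r a j => eta (r, a, j)) xi delta eps lam tau ROUND r B w).
rewrite (eq_bigr (fun c => (pull_weight r B c * (dot (feat c) theta + e c)) *: feat c)).
  rewrite (regression_decomposition dot feat c0 (pull_weight_ge0 r B)) -/(dual r B y).
  rewrite /noise sum_samples => E.
  rewrite (eq_bigr (fun c => pull_weight r B c * e c * dot (dual r B y) (feat c))).
    rewrite -E /Defs.gap_estimate; congr ((_^T *m _ *m _) _ _).
    by apply/colP => i; rewrite !mxE -mulrBr -dotBl.
  by move=> c _; rewrite we mulr_suml; apply: eq_bigr => j _; rewrite mulrC.
move=> c _; congr (_ *: _); rewrite mulrDr we /mean_outcome big_split /=.
rewrite sumr_const card_ord /pull_weight.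
have [->|p0] := posnP (pulls r B c); first by rewrite big_ord0 !mul0r addr0.
by rewrite -mulr_natl; field; rewrite pnatr_eq0 -lt0n.
Qed.

(** * Accuracy of the gap estimates and elimination *)

Section Guarantees.
Hypotheses (V0 : (0 < V)%N) (n1 : (1 < n)%N) (delta01 : 0 < delta < 1).
Hypothesis lam_opt : forall B, optimal_design dot feat xi B (lam B).
Hypothesis ROUND_spec : forall B N, (tau xi (lam B) eps <= N)%N ->
  round_guarantee dot feat xi eps B (lam B) (ROUND xi (lam B) N eps).

Definition log_term r : R := ln (2 * n%:R ^+ 2 * V%:R / delta_ delta r).

Lemma lam_ge0 B a : 0 <= lam B a.
Proof. by case: (lam_opt B) => -[]. Qed.

Lemma rho_ge0 B : 0 <= rho B.
Proof. exact: max_pairs_ge0. Qed.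

Lemma invq_le_rho B v i j : i \in B v -> j \in B v ->
  invq dot feat xi (lam B) (feat (v, i) - feat (v, j)) <= rho B.
Proof.
move=> Bi Bj; rewrite -(sqr_inv_norm dot feat xi0 (lam_ge0 B)).
exact: (max_pairs_ub (fun a b => inv_norm dot (regop dot feat xi (lam B)) (feat a - feat b) ^+ 2)).
Qed.

(** The design for the full sets also competes on the smaller sets [B]. This carries the hypothesis
    on xi, stated for the full sets, over to every round. *)
Lemma rho_le_full B : rho B <= rho (all_arms V n).
Proof.
have [_ /(_ (lam (all_arms V n)) (proj1 (lam_opt _)))] := lam_opt B.
move=> h; apply: le_trans h _; apply: max_pairs_le => [|v i j _ _].
  exact: rho_ge0.
have := @max_pairs_ub R V n (all_arms V n) (fun a b =>
  inv_norm dot (reg_op dot feat xi (lam (all_arms V n))) (feat a - feat b) ^+ 2) v i j.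
by apply; rewrite ffunE inE.
Qed.

Lemma delta_gt0 r : (0 < r)%N -> 0 < delta_ delta r.
Proof.
move=> r0; case/andP: delta01 => d0 _.
by rewrite divr_gt0 // mulr_gt0 // exprn_gt0 // ltr0n.
Qed.

Lemma log_arg_gt1 r : (0 < r)%N -> 1 < 2 * n%:R ^+ 2 * V%:R / delta_ delta r.
Proof.
move=> r0; case/andP: delta01 => d0 d1.
rewrite ltr_pdivlMr ?delta_gt0 // mul1r.
apply: (@lt_le_trans _ _ 1).
  rewrite /delta_ ltr_pdivrMr ?mul1r; last by rewrite mulr_gt0 // exprn_gt0 // ltr0n.
  apply: lt_le_trans d1 _; have : (1 : R) <= r%:R ^+ 2 by rewrite exprn_ege1 // ler1n.
  lra.
have n2 : (1 : R) <= n%:R ^+ 2 by rewrite exprn_ege1 // ler1n ltnW.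
have v1 : (1 : R) <= V%:R by rewrite ler1n.
have : (1 : R) <= 2 * n%:R ^+ 2 by lra.
by move=> h; rewrite mulr_ege1.
Qed.

Lemma log_term_gt0 r : (0 < r)%N -> 0 < log_term r.
Proof. by move=> r0; rewrite ln_gt0 // log_arg_gt1. Qed.

Lemma le_budget r B :
  32 * (2 ^+ r) ^+ 2 * (1 + eps) ^+ 2 * rho B * log_term r <= (budget r B)%:R.
Proof.
apply: (le_trans (ceil_ge _)).
apply: (@le_trans _ _ (`|Num.ceil (32 * (2 ^+ r) ^+ 2 * (1 + eps) ^+ 2
    * rho B * log_term r)|%N)%:R).
  by rewrite natr_absz ler_int ler_norm.
by rewrite ler_nat leq_maxl.
Qed.

(** The rounding guarantee followed by scaling by the budget; 22 / 10 is 2 (1 + eps). *)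
Lemma invq_sampled_le r B v i j : (0 < budget r B)%N -> i \in B v -> j \in B v ->
  invq dot feat ((budget r B)%:R * xi) (pull_weight r B) (feat (v, i) - feat (v, j))
  <= 22 / 10 * rho B / (budget r B)%:R.
Proof.
move=> N0 Bi Bj; have Np : 0 < (budget r B)%:R :> R by rewrite ltr0n.
have c0 : 0 < (budget r B)%:R * xi by rewrite mulr_gt0.
rewrite -(sqr_inv_norm dot feat c0 (pull_weight_ge0 r B)) -sampled_opE.
set M := sampled_op _ _ _ _.
apply: (le_trans (max_pairs_ub (fun a b => inv_norm dot M (feat a - feat b) ^+ 2) Bi Bj)).
have tN : (tau xi (lam B) eps <= budget r B)%N by exact: leq_maxr.
apply: le_trans (ROUND_spec tN) _.
have : sq_width dot feat B (planned_op dot feat xi (budget r B) (lam B))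
    <= rho B / (budget r B)%:R.
  apply: max_pairs_le => [|u k l Bk Bl]; first by rewrite divr_ge0 ?rho_ge0.
  have -> h : inv_norm dot (planned_op dot feat xi (budget r B) (lam B)) h ^+ 2
      = invq dot feat xi (lam B) h / (budget r B)%:R.
    rewrite -(invq_scale dot feat xi0 (lam_ge0 B)) //.
    apply: (sqr_inv_norm dot feat c0) => a.
    by rewrite mulr_ge0 ?lam_ge0.
  by rewrite ler_pM2r ?invr_gt0 // invq_le_rho.
move=> h; have -> : 22 / 10 * rho B / (budget r B)%:R
    = 2 * (1 + eps) * (rho B / (budget r B)%:R) by field; rewrite gt_eqF.
by rewrite ler_wpM2l //; lra.
Qed.

(** [invq_sampled_le] and [le_budget] give 2.2 / (32 * 1.21) = 1 / 17.6 as the constant; 16 is a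
    rounding of 17.6. *)
Definition variance_proxy r : R := (16 * (2 ^+ r) ^+ 2 * log_term r)^-1.

Lemma variance_proxy_gt0 r : (0 < r)%N -> 0 < variance_proxy r.
Proof. by move=> r0; rewrite invr_gt0 !mulr_gt0 ?log_term_gt0 ?exprn_gt0. Qed.

Lemma noise_variance r B v i j : (0 < r)%N -> i \in B v -> j \in B v ->
  \sum_(t <- samples r B) dot (dual r B (feat (v, i) - feat (v, j))) (feat t.1.2) ^+ 2
  <= variance_proxy r.
Proof.
move=> r0 Bi Bj; set g := dual _ _ _; rewrite sum_samples.
have -> : \sum_a \sum_(j0 < pulls r B a) dot g (feat (r, a, j0 : nat).1.2) ^+ 2
    = \sum_a pull_weight r B a * dot g (feat a) ^+ 2.
  by apply: eq_bigr => a _; rewrite /= sumr_const card_ord mulr_natl.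
have [N0|N0] := posnP (budget r B).
  rewrite big1 ?(ltW (variance_proxy_gt0 _)) // => a _.
  by rewrite /pull_weight pulls_budget0 // mul0r.
have Np : 0 < (budget r B)%:R :> R by rewrite ltr0n.
have c0 : 0 < (budget r B)%:R * xi by rewrite mulr_gt0.
apply: (le_trans (variance_le_invq dot feat c0 (pull_weight_ge0 r B) _)).
apply: (le_trans (invq_sampled_le N0 Bi Bj)).
rewrite ler_pdivrMr // -ler_pdivrMl ?variance_proxy_gt0 //.
apply: le_trans (le_budget r B); rewrite /variance_proxy invrK.
have : 0 <= (2 ^+ r) ^+ 2 * rho B * log_term r.
  by rewrite !mulr_ge0 ?rho_ge0 ?sqr_ge0 // ltW // log_term_gt0.
by move: (rho B) (log_term r) ((2 ^+ r) ^+ 2) => x y z; lra.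
Qed.

Variable gap : R.
Hypotheses (gap0 : 0 < gap)
  (xi_small : 22 / 10 * xi * rho (all_arms V n) * dot theta theta <= (gap / 20) ^+ 2).

(** An upper bound suffices: estimates are antisymmetric, so exchanging [i] and [j] gives the lower
    bound. *)
Lemma gap_estimate_lt r B w v i j t : (0 < r)%N -> i \in B v -> j \in B v ->
  0 < t -> noise r B (feat (v, i) - feat (v, j)) w < t ->
  gap_estimate r B w (v, i) (v, j) < F (v, i) - F (v, j) + t + gap / 20.
Proof.
move=> r0 Bi Bj t0 nt; rewrite -dotBl; set y := feat _ - feat _ in nt *.
(* A zero budget forces [rho B] = 0, hence equal features for the two arms: the true and the
   estimated gap are both 0. *)
have [N0|N0] := posnP (budget r B).
  rewrite gap_estimate_budget0 //; suff -> : dot y theta = 0 by rewrite add0r addr_gt0 ?divr_gt0.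
  have r00 : rho B = 0.
    apply/eqP; rewrite eq_le rho_ge0 andbT leNgt; apply/negP => rp.
    have := le_budget r B; rewrite N0 leNgt => /negP; apply.
    rewrite !mulr_gt0 ?log_term_gt0 ?exprn_gt0 //; lra.
  have := dot_le_invq dot feat xi0 (lam_ge0 B) y.
  have -> : invq dot feat xi (lam B) y = 0.
    apply/eqP; rewrite eq_le invq_ge0 //; last exact: lam_ge0.
    by rewrite andbT -r00 invq_le_rho.
  rewrite mulr0 => yy; have : dot y y == 0 by rewrite eq_le yy dot_ge0.
  by rewrite dot_eq0 => /eqP ->; rewrite dotC dot0r.
rewrite gap_estimate_decomposition // -/y.
have Np : 0 < (budget r B)%:R :> R by rewrite ltr0n.
have c0 : 0 < (budget r B)%:R * xi by rewrite mulr_gt0.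
have := bias_le_invq dot feat c0 (pull_weight_ge0 r B) y theta.
rewrite -/(dual r B y); set b := _ * dot (dual _ _ _) _ => hb.
have : b ^+ 2 <= (gap / 20) ^+ 2.
  apply: le_trans hb (le_trans _ xi_small); rewrite ler_wpM2r ?dot_ge0 //.
  apply: (@le_trans _ _ ((budget r B)%:R * xi * (22 / 10 * rho B / (budget r B)%:R))).
    by rewrite ler_wpM2l ?(ltW c0) // invq_sampled_le.
  have -> : (budget r B)%:R * xi * (22 / 10 * rho B / (budget r B)%:R)
      = 22 / 10 * xi * rho B by field; rewrite gt_eqF.
  by rewrite ler_wpM2l ?rho_le_full // mulr_ge0 ?divr_ge0 ?(ltW xi0).
rewrite -(real_normK (num_real b)) ler_pXn2r ?nnegrE ?normr_ge0 ?divr_ge0 ?(ltW gap0) //.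
rewrite ler_norml => /andP [hb1 _].
move: hb1 nt; rewrite lerNl; move: (noise _ _ _ _) (dot y theta) (- b) (gap / 20) => x1 x2 x3 x4.
lra.
Qed.

Variable best : 'I_V -> 'I_n.
Hypothesis best_gap : forall v i, i != best v -> gap <= F (v, best v) - F (v, i).

Definition calm r B (w : Om) : Prop := forall v i j, i \in B v -> j \in B v ->
  noise r B (feat (v, i) - feat (v, j)) w < 2 ^- r / 2.

Lemma half_pow_gt0 r : 0 < 2 ^- r / 2 :> R.
Proof. by rewrite divr_gt0 // invr_gt0 exprn_gt0. Qed.

Lemma best_survives r B w : (0 < r)%N -> calm r B w ->
  (forall v, best v \in B v) -> forall v, best v \in eliminate r B w v.
Proof.
move=> r0 cB Bbest v; rewrite ffunE !inE Bbest andbT /=.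
apply/existsPn => i; apply/negP => /andP [Bi]; apply/negP; rewrite -ltNge.
have [->|ib] := eqVneq i (best v).
  have : gap_estimate r B w (v, best v) (v, best v) = 0.
    have := gap_estimateN r B w (v, best v) (v, best v); move: (gap_estimate _ _ _ _ _) => x; lra.
  by move=> ->; rewrite invr_gt0 exprn_gt0.
apply: lt_trans (gap_estimate_lt r0 Bi (Bbest v) (half_pow_gt0 r) (cB v _ _ Bi (Bbest v))) _.
have := best_gap ib; have := half_pow_gt0 r; move: gap0.
move: (F (v, i)) (F (v, best v)) (2 ^- r) gap => x1 x2 x3 g; lra.
Qed.

(** The estimated gap exceeds gap - gap / 20 - 2^-r / 2, and gap >= 2 * 2^-r makes this at least 1.4
    * 2^-r. *)
Lemma others_eliminated r B w : (0 < r)%N -> calm r B w ->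
  (forall v, best v \in B v) -> 2 ^- r <= gap / 2 -> settled (eliminate r B w).
Proof.
move=> r0 cB Bbest rgap v; apply/eqP/cards1P; exists (best v); apply/setP => i.
rewrite [in RHS]inE; have [->|ib] := eqVneq i (best v); first exact: best_survives.
rewrite ffunE !inE; case Bi: (i \in B v); rewrite ?andbF // andbT.
apply/negbTE; rewrite negbK; apply/existsP; exists (best v); rewrite Bbest /=.
have := gap_estimate_lt r0 Bi (Bbest v) (half_pow_gt0 r) (cB v _ _ Bi (Bbest v)).
rewrite gap_estimateN; have := best_gap ib; move: rgap gap0.
move: (F (v, i)) (F (v, best v)) (2 ^- r) gap (gap_estimate _ _ _ _ _) => x1 x2 x3 g x4; lra.
Qed.

Local Notation candidates := (candidates dot feat (gram dot feat) F
  (fun r a j => eta (r, a, j)) xi delta eps lam tau ROUND).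
Local Notation stops_at := (stops_at dot feat (gram dot feat) F
  (fun r a j => eta (r, a, j)) xi delta eps lam tau ROUND).
Local Notation sample_complexity := (sample_complexity dot feat (gram dot feat) F
  (fun r a j => eta (r, a, j)) xi delta eps lam tau ROUND).

Lemma candidatesS r w : (0 < r)%N ->
  candidates r.+1 w = eliminate r (candidates r w) w.
Proof. by case: r. Qed.

Lemma best_in_candidates m w :
  (forall r, (0 < r <= m)%N -> calm r (candidates r w) w) ->
  forall r, (r <= m)%N -> forall v, best v \in candidates r.+1 w v.
Proof.
move=> cw; elim=> [|r IHr] rm v; first by rewrite /= ffunE inE.
rewrite candidatesS //; apply: best_survives => //; first by apply: cw.
by move=> u; apply: IHr; exact: ltnW.
Qed.

Lemma stops_early m w : (0 < m)%N -> 2 ^- m <= gap / 2 ->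
  (forall r, (0 < r <= m)%N -> calm r (candidates r w) w) ->
  exists2 r, (r <= m)%N & stops_at w r.
Proof.
move=> m0 mgap cw.
have sm : settled (candidates m.+1 w).
  rewrite candidatesS //; apply: others_eliminated => //.
    by apply: cw; rewrite m0 leqnn.
  by case: m m0 {mgap} cw => // m _ cw; apply: (best_in_candidates cw).
have ex : exists r, (0 < r)%N && `[< settled (candidates r.+1 w) >].
  by exists m; rewrite m0; apply/asboolP.
have [r /andP [r0 /asboolP sr] rmin] := ex_minnP ex.
exists r; first by apply: rmin; rewrite m0 /=; apply/asboolP.
split => // r' /andP [r'0 r'r] sr'.
have : (r <= r')%N by apply: rmin; rewrite r'0 /=; apply/asboolP.
by rewrite leqNgt r'r.
Qed.

Lemma sample_complexity_le m w K : (0 < m)%N -> 2 ^- m <= gap / 2 -> 0 <= K ->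
  (forall r, (0 < r <= m)%N -> calm r (candidates r w) w) ->
  (forall r B, (0 < r <= m)%N -> (budget r B)%:R <= K) ->
  (sample_complexity w <= (m%:R * K / V%:R)%:E)%E.
Proof.
move=> m0 mgap K0 cw bK; have [r rm sr] := stops_early m0 mgap cw.
apply: (@le_trans _ _ ((\sum_(1 <= r' < r.+1) budget r' (candidates r' w))%:R / V%:R)%:E).
  by apply: ereal_inf_lbound; exists r.
rewrite lee_fin ler_wpM2r ?invr_ge0 // natr_sum.
apply: (@le_trans _ _ (\sum_(1 <= r' < r.+1) K)).
  rewrite big_nat [leRHS]big_nat; apply: ler_sum => r' /andP [r0 r'r].
  by apply: bK; rewrite r0 (leq_trans _ rm).
by rewrite sumr_const_nat subn1 -[leLHS]mulr_natl ler_wpM2r // ler_nat.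
Qed.

Lemma budget_le r B : (0 < r)%N -> (budget r B)%:R <=
  32 * (2 ^+ r) ^+ 2 * (1 + eps) ^+ 2 * rho B * log_term r + 1
  + (tau xi (lam B) eps)%:R.
Proof.
move=> r0; rewrite /Defs.budget -/(log_term r).
have : 0 <= 32 * (2 ^+ r) ^+ 2 * (1 + eps) ^+ 2 * rho B * log_term r.
  rewrite !mulr_ge0 ?rho_ge0 ?sqr_ge0 //; exact/ltW/log_term_gt0.
set x := _ * log_term r => x0.
have cx : (`|Num.ceil x|%N)%:R <= x + 1.
  have c0 : 0 <= Num.ceil x by rewrite ceil_ge0; apply: lt_le_trans x0; rewrite ltrN10.
  rewrite natr_absz ger0_norm //; have := ceil_itv x => /andP [h _].
  by move: h; rewrite intrD /=; lra.
rewrite -[leRHS]addr0 natr_max ge_max; apply/andP; split.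
  apply: le_trans cx _; rewrite addr0 lerDl; exact: ler0n.
by rewrite addr0 lerDr addr_ge0.
Qed.

End Guarantees.
End Algorithm.

(** * Concentration *)

(** Telescoping: 1 / (m + 1)^2 <= 2 / (m + 1) - 2 / (m + 2). *)
Lemma sum_inv_sqr_le (R : realFieldType) (m : nat) :
  \sum_(r < m) ((r.+1)%:R ^+ 2)^-1 <= 2 - 2 / (m.+1)%:R :> R.
Proof.
elim: m => [|m IHm]; first by rewrite big_ord0 divr1 subrr.
rewrite big_ord_recr /=; apply: le_trans (lerD IHm (lexx _)) _.
have m1 : 0 < m.+1%:R :> R by rewrite ltr0n.
have m2 : 0 < m.+2%:R :> R by rewrite ltr0n.
rewrite -addrA lerD2l -subr_ge0.
have -> : - (2 / m.+2%:R) - (- (2 / m.+1%:R) + (m.+1%:R ^+ 2)^-1)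
    = (2 * m.+1%:R - m.+2%:R) / (m.+1%:R ^+ 2 * m.+2%:R) :> R.
  rewrite -[m.+2%:R]natr1 in m2 *; move: m2 m1; move: (m.+1%:R : R) => x x1 x0.
  by field; rewrite !gt_eqF.
rewrite divr_ge0 ?mulr_ge0 ?sqr_ge0 ?(ltW m2) // subr_ge0 -natrM ler_nat.
by rewrite mulSn mul1n addSn addnS !ltnS leq_addr.
Qed.

Section Concentration.
Context {R : realType} {H : lmodType R} {V n : nat}.
Context {d : measure_display} {Om : measurableType d}.
Variable P : probability Om R.
Variables (dot : {dot H for idfun}) (feat : arm V n -> H) (theta : H).
Variable eta : nat * arm V n * nat -> {RV P >-> R}.
Variables (delta xi : R) (lam : arm_sets V n -> {ffun arm V n -> R}).
Variable tau : R -> {ffun arm V n -> R} -> R -> nat.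
Variable ROUND : R -> {ffun arm V n -> R} -> forall N : nat, R -> N.-tuple (arm V n).

Implicit Types (B : arm_sets V n) (v : 'I_V).
Local Notation eps := (10^-1).
Local Notation F := (fun a => dot (feat a) theta).
Local Notation budget := (budget dot feat xi delta eps lam tau).
Local Notation pulls := (pulls dot feat xi delta eps lam tau ROUND).
Local Notation gap_estimate := (gap_estimate dot feat (gram dot feat) F
  (fun r a j => eta (r, a, j)) xi delta eps lam tau ROUND).
Local Notation eliminate := (eliminate dot feat (gram dot feat) F
  (fun r a j => eta (r, a, j)) xi delta eps lam tau ROUND).
Local Notation candidates := (candidates dot feat (gram dot feat) F
  (fun r a j => eta (r, a, j)) xi delta eps lam tau ROUND).
Local Notation noise := (noise dot feat eta delta xi lam tau ROUND).
Local Notation calm := (calm dot feat eta delta xi lam tau ROUND).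
Local Notation stops_at := (stops_at dot feat (gram dot feat) F
  (fun r a j => eta (r, a, j)) xi delta eps lam tau ROUND).
Local Notation sample_complexity := (sample_complexity dot feat (gram dot feat) F
  (fun r a j => eta (r, a, j)) xi delta eps lam tau ROUND).

Definition before r : pred (nat * arm V n * nat) := fun t => (t.1.1 < r)%N.
Definition during r : pred (nat * arm V n * nat) := fun t => t.1.1 == r.

Lemma noise_measurable r B y : cyl_measurable eta (during r) (noise r B y).
Proof.
rewrite (_ : noise r B y = fun w => \sum_a \sum_(j < pulls r B a)
    dot (dual dot feat delta xi lam tau ROUND r B y) (feat a) * eta (r, a, j : nat) w); last first.
  by apply/funext => w; exact: sum_samples.
apply: measurable_sum => a; apply: measurable_sum => j; apply: measurable_funM => //.
by apply: cyl_measurable1; rewrite /during.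
Qed.

Lemma gap_estimate_measurable r B a b :
  cyl_measurable eta (before r.+1) (fun w => gap_estimate r B w a b).
Proof.
rewrite /Defs.gap_estimate; set M := (_ *m invmx _).
rewrite (_ : (fun _ => _) = fun w => \sum_i M ord0 i *
   outcome_col dot feat F (fun r a j => eta (r, a, j)) xi delta eps lam tau ROUND
     r B w i ord0); last first.
  by apply/funext => w; rewrite mxE.
apply: measurable_sum => i; apply: measurable_funM => //.
under eq_fun do rewrite mxE.
apply: measurable_funM => //; apply: measurable_funM => //.
apply: measurable_sum => j; apply: measurable_funD => //.
by apply: cyl_measurable1; rewrite /before.
Qed.

Definition past_measurable (T : finType) r (f : Om -> T) :=
  @fin_measurable _ (g_sigma_algebraType (cylinders eta (before r))) T f.

Lemma past_measurableS (T : finType) r (f : Om -> T) :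
  past_measurable r f -> past_measurable r.+1 f.
Proof.
move=> mf t; apply: (@sub_cylinders _ _ _ _ _ eta (before r)); last exact: mf.
by move=> s; rewrite /before => /ltnW.
Qed.

Lemma eliminate_measurable r B : past_measurable r.+1 (eliminate r B).
Proof.
(* Elimination sees the outcomes only through a finite table of comparisons with the threshold. *)
pose g (h : {ffun arm V n * arm V n -> bool}) : arm_sets V n :=
  [ffun v => B v :\: [set i in B v | [exists i' in B v, h ((v, i'), (v, i))]]]%SET.
have -> : eliminate r B =
    (fun w => g [ffun p => 2 ^- r <= gap_estimate r B w p.1 p.2]).
  apply/funext => w; apply/ffunP => v; rewrite !ffunE; congr (_ :\: _)%SET.
  apply/setP => i; rewrite !inE; congr (_ && _); apply: eq_existsb => i'.
  by rewrite ffunE.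
apply: fin_measurable_comp; apply: fin_measurable_ffun => p.
apply: fin_measurable_le; exact: gap_estimate_measurable.
Qed.

Lemma candidates_past r : past_measurable r (candidates r).
Proof.
elim: r => [|[|r] IHr]; [exact: fin_measurable_cst|exact: fin_measurable_cst|].
(* The argument of [eliminate] is itself random: tabulate its result for every [B], then evaluate
   the table at the current sets. *)
pose g (p : arm_sets V n * {ffun arm_sets V n -> arm_sets V n}) := p.2 p.1.
have -> : candidates r.+2 =
    (fun w => g (candidates r.+1 w, [ffun B => eliminate r.+1 B w])).
  by apply/funext => w; rewrite /g /= ffunE.
apply: fin_measurable_comp; apply: fin_measurable_pair.
  exact: past_measurableS.
by apply: fin_measurable_ffun => B; exact: eliminate_measurable.
Qed.

Lemma candidates_measurable r : fin_measurable (candidates r).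
Proof.
move=> B; apply: (@sigma_cylinders_measurable _ _ _ _ _ eta (before r)).
exact: candidates_past.
Qed.

Lemma sample_complexity_measurable (c : R) :
  measurable [set w | (sample_complexity w <= c%:E)%E].
Proof.
(* Stopping in round r at cost at most c, read off a finite history; it reaches index r + 1 because
   stopping in round r inspects the sets after that round. *)
pose A r (h : {ffun 'I_r.+2 -> arm_sets V n}) :=
  [/\ (0 < r)%N, settled (h (inord r.+1)),
     forall r', (0 < r' < r)%N -> ~ settled (h (inord r'.+1)) &
     (\sum_(1 <= r' < r.+1) budget r' (h (inord r')))%:R / V%:R <= c].
have -> : [set w | (sample_complexity w <= c%:E)%E] = \bigcup_r
    [set w | A r [ffun i : 'I_r.+2 => candidates i w]].
  have AE r w : A r [ffun i : 'I_r.+2 => candidates i w] <->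
      stops_at w r /\ (\sum_(1 <= r' < r.+1) budget r' (candidates r' w))%:R / V%:R <= c.
    have E r' : (r' <= r.+1)%N -> [ffun i : 'I_r.+2 => candidates i w] (inord r') = candidates r' w.
      by move=> h; rewrite ffunE inordK.
    have sE : (\sum_(1 <= r' < r.+1) budget r' ([ffun i : 'I_r.+2 => candidates i w] (inord r'))
        = \sum_(1 <= r' < r.+1) budget r' (candidates r' w))%N.
      by rewrite big_nat [RHS]big_nat; apply: eq_bigr => r' /andP [_ h]; rewrite E // ltnW.
    rewrite /A sE E //; split.
      move=> [r0 sr rmin sc]; split => //; split => // r' h; rewrite -E; first exact: rmin.
      by case/andP: h => _ h; rewrite ltnW.
    move=> [[r0 sr rmin] sc]; split => // r' h; rewrite E; first exact: rmin.
    by case/andP: h => _ h; rewrite ltnW.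
  apply/seteqP; split => [w /= Sc|w [r _ /= /AE [sr sc]]]; last first.
    apply: (@le_trans _ _ ((\sum_(1 <= r' < r.+1) budget r' (candidates r' w))%:R / V%:R)%:E).
      by apply: ereal_inf_lbound; exists r.
    by rewrite lee_fin.
  have [[r sr]|nr] := pselect (exists r, stops_at w r); last first.
    move: Sc; rewrite /Defs.sample_complexity (_ : [set _ | _ in _] = set0) ?ereal_inf0 //.
    by apply/seteqP; split => // _ [r sr <-]; apply: nr; exists r.
  exists r => //=; apply/AE; split => //.
  rewrite -lee_fin; apply: le_trans Sc; apply: le_ereal_inf_tmp => _ [r' sr' <-].
  (* Both are the first settled round, so the infimum is over a single value. *)
  suff -> : r' = r by [].
  case: sr sr' => r0 s rmin [r'0 s' r'min].
  have [lt|lt|//] := ltngtP r' r.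
    by have := rmin r'; rewrite r'0 lt => /(_ isT).
  by have := r'min r; rewrite r0 lt => /(_ isT).
apply: bigcupT_measurable => r.
apply: (@fin_measurable_set _ _ _ (fun w => [ffun i : 'I_r.+2 => candidates i w]) (A r)).
by apply: fin_measurable_ffun => i; exact: candidates_measurable.
Qed.

Hypothesis xi0 : 0 < xi.
Hypotheses (V0 : (0 < V)%N) (n1 : (1 < n)%N) (delta01 : 0 < delta < 1).
Hypothesis lam_opt : forall B, optimal_design dot feat xi B (lam B).
Hypothesis ROUND_spec : forall B N, (tau xi (lam B) eps <= N)%N ->
  round_guarantee dot feat xi eps B (lam B) (ROUND xi (lam B) N eps).
Hypothesis indep : mutually_independent eta.
Hypothesis sg : forall t, one_subgaussian (eta t).

Definition large_noise r B (p : 'I_V * 'I_n * 'I_n) : set Om :=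
  [set w | (p.1.2 \in B p.1.1) && (p.2 \in B p.1.1) &&
    (2 ^- r / 2 <= noise r B (feat (p.1.1, p.1.2) - feat (p.1.1, p.2)) w)].

Lemma not_calmE r B : [set w | ~ calm r B w] = \bigcup_p large_noise r B p.
Proof.
apply/seteqP; split => w /=.
  move=> nc; apply: contrapT => nG; apply: nc => v i j Bi Bj.
  rewrite ltNge; apply/negP => h; apply: nG; exists (v, i, j) => //.
  by rewrite /large_noise /= Bi Bj.
move=> [[[v i] j] _ /= /andP [/andP [Bi Bj] h]] /(_ v i j Bi Bj).
by rewrite ltNge h.
Qed.

Lemma large_noise_during r B p :
  <<s cylinders eta (during r) >> (large_noise r B p).
Proof.
pose T := g_sigma_algebraType (cylinders eta (during r)).
rewrite /large_noise; case: ((p.1.2 \in B p.1.1) && (p.2 \in B p.1.1)) => /=; last first.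
  rewrite (_ : [set _ | _] = set0); first exact: (@measurable0 _ T).
  by apply/seteqP; split.
exact: (@fin_measurable_le _ T _ _ _ (@noise_measurable r B _) true).
Qed.

Lemma not_calm_during r B : <<s cylinders eta (during r) >> [set w | ~ calm r B w].
Proof.
rewrite not_calmE.
apply: (@fin_bigcup_measurable _ (g_sigma_algebraType (cylinders eta (during r)))).
  exact: finite_finset.
by move=> p _; exact: large_noise_during.
Qed.

Lemma large_noise_probability r B p : (0 < r)%N ->
  (P (large_noise r B p) <= (expR (- @log_term R V n delta r))%:E)%E.
Proof.
move=> r0; have L0 : 0 < @log_term R V n delta r by exact: log_term_gt0.
rewrite /large_noise; case Bp: ((p.1.2 \in B p.1.1) && (p.2 \in B p.1.1)) => /=; last first.
  rewrite (_ : [set _ | _] = set0); last by apply/seteqP; split.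
  by rewrite measure0 lee_fin expR_ge0.
case/andP: Bp => Bi Bj.
have vp : 0 < @variance_proxy R V n delta r by exact: variance_proxy_gt0.
have nv := noise_variance xi0 V0 n1 delta01 lam_opt ROUND_spec r0 Bi Bj.
have us := uniq_samples dot feat delta xi lam tau ROUND r B.
have h := subgaussian_tail indep sg us vp (half_pow_gt0 r) nv.
apply: le_trans h _.
rewrite lee_fin ler_expR lerN2 /variance_proxy.
have r2 : 2 ^+ r != 0 :> R by rewrite gt_eqF // exprn_gt0.
move: (log_term _ _) L0 => L L0.
(* The exponent is twice the L required. *)
have -> : (2 ^- r / 2) ^+ 2 / (2 * (16 * (2 ^+ r) ^+ 2 * L)^-1) = 2 * L.
  by field; rewrite r2 gt_eqF.
by lra.
Qed.

(** The V n^2 ordered pairs cancel against the factor 2 n^2 V inside the logarithm. *)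
Lemma not_calm_probability r B : (0 < r)%N ->
  (P [set w | ~ calm r B w] <= (delta_ delta r / 2)%:E)%E.
Proof.
move=> r0; rewrite not_calmE.
have mG p : measurable (large_noise r B p).
  exact: (@sigma_cylinders_measurable _ _ _ _ _ eta (during r) _ (large_noise_during _ _)).
have mU : measurable (\bigcup_p large_noise r B p).
  by apply: fin_bigcup_measurable => //; exact: finite_finset.
apply: le_trans (union_bound P mU mG (@subset_refl _ _)) _.
apply: le_trans (lee_sum _ (fun p _ => large_noise_probability B p r0)) _.
rewrite sumEFin lee_fin sumr_const !card_prod !card_ord -[leLHS]mulr_natl.
have nn : n%:R != 0 :> R by rewrite pnatr_eq0 -lt0n ltnW.
have vv : V%:R != 0 :> R by rewrite pnatr_eq0 -lt0n.
have dd := delta_gt0 delta01 r0.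
have a0 : 0 < 2 * n%:R ^+ 2 * V%:R / delta_ delta r.
  by apply: lt_trans ltr01 _; exact: log_arg_gt1.
rewrite expRN /log_term lnK ?posrE // !natrM le_eqVlt; apply/orP; left; apply/eqP.
by field; rewrite nn vv (gt_eqF dd).
Qed.

(** Split by the value [B] of the candidate sets. That they equal [B] is an event of earlier rounds,
    that [B] is not calm is an event of the current one, so the probabilities multiply; summing over
    [B] leaves delta / (4 r^2), and over r at most delta / 2. *)
Lemma calm_probability m :
  measurable [set w | forall r, (0 < r <= m)%N -> calm r (candidates r w) w] /\
  ((1 - delta)%:E <=
   P [set w | forall r, (0 < r <= m)%N -> calm r (candidates r w) w])%E.
Proof.
pose Bad (p : 'I_m * arm_sets V n) : set Om :=
  [set w | candidates p.1.+1 w = p.2] `&` [set w | ~ calm p.1.+1 p.2 w].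
have mBad p : measurable (Bad p).
  apply: measurableI; first exact: candidates_measurable.
  exact: (@sigma_cylinders_measurable _ _ _ _ _ eta (during p.1.+1) _ (not_calm_during _)).
set good := [set w | _].
have goodE : good = ~` \bigcup_p Bad p.
  apply/seteqP; split => w /=.
    move=> gw [[r B] _ [/= cB]]; apply; rewrite -cB; apply: gw.
    by rewrite /= ltn_ord.
  move=> nb [//|r] rm; apply: contrapT => nc; apply: nb.
  by exists (Ordinal (rm : (r < m)%N), candidates r.+1 w).
have mU : measurable (\bigcup_p Bad p).
  by apply: fin_bigcup_measurable => //; exact: finite_finset.
rewrite goodE; split; first exact: measurableC.
rewrite probability_setC // EFinB leeB //.
apply: le_trans (union_bound P mU mBad (@subset_refl _ _)) _.
apply: (@le_trans _ _ (\sum_(p : 'I_m * arm_sets V n)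
   P [set w | candidates p.1.+1 w = p.2] * (delta_ delta p.1.+1 / 2)%:E)%E).
  apply: lee_sum => p _; rewrite /Bad (sigma_cylinders_indep indep _
     (@candidates_past p.1.+1 p.2) (not_calm_during p.2)).
    by apply: lee_wpmul2l => //; exact: not_calm_probability.
  by move=> t; rewrite /before /during ltn_neqAle => /andP [].
rewrite -(pair_bigA _ (fun (r : 'I_m) B =>
  P [set w | candidates r.+1 w = B] * (delta_ delta r.+1 / 2)%:E)%E) /=.
apply: (@le_trans _ _ (\sum_(r < m) (delta_ delta r.+1 / 2)%:E)%E).
  apply: lee_sum => r _; rewrite -ge0_sume_distrl //.
  by rewrite (sum_probability_fibers P (candidates_measurable r.+1)) mul1e.
case/andP: delta01 => d0 _.
rewrite sumEFin lee_fin.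
rewrite (eq_bigr (fun r : 'I_m => delta / 4 * ((r.+1)%:R ^+ 2)^-1)); last first.
  move=> r _; have : (r.+1)%:R != 0 :> R by rewrite pnatr_eq0.
  by rewrite /delta_; move: (r.+1%:R : R) => x x0; field.
rewrite -mulr_sumr; have := sum_inv_sqr_le R m.
have : 0 <= 2 / m.+1%:R :> R by rewrite divr_ge0.
move: (2 / m.+1%:R) (\sum_(_ < m) _) => x y x0 yx.
have y2 : y <= 2 by lra.
apply: (@le_trans _ _ (delta / 4 * 2)); last by lra.
by rewrite ler_wpM2l // divr_ge0 // ltW.
Qed.

End Concentration.

(** * The sample complexity *)

Section Rounds.
Context {R : realType}.
Implicit Types gap : R.

Lemma ln2_ge_half : 2^-1 <= ln 2 :> R.
Proof. by have := @ln1D_ge R 1 ler01; rewrite div1r. Qed.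

(** For gap < 1 the least admissible m has 2^m <= 4 / gap. For gap >= 1 one round is still run
    although 1 / gap^2 may be tiny; this is why the constant involves [gap_bound]. *)
Lemma exists_round_bound gap gap_bound : 0 < gap -> gap <= gap_bound ->
  exists m : nat, [/\ (0 < m)%N, 2 ^- m <= gap / 2,
    (2 ^+ m) ^+ 2 <= (16 + 4 * gap_bound ^+ 2) / gap ^+ 2 &
    m%:R <= 4 * (1 + ln (1 + gap^-1))].
Proof.
move=> g0 gb; have g2 : 0 < gap ^+ 2 by rewrite exprn_gt0.
have lg : 0 <= ln (1 + gap^-1) by rewrite ln_ge0 // lerDl invr_ge0 ltW.
have [g1|g1] := leP 1 gap.
  exists 1%N; split => //.
  - by rewrite expr1 -[leLHS]mul1r ler_pM2r // invr_gt0.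
  - rewrite expr1 ler_pdivlMr // expr2 -natrM.
    have : gap ^+ 2 <= gap_bound ^+ 2.
      by rewrite ler_pXn2r // nnegrE ltW // (lt_le_trans g0).
    by move=> h; rewrite -[leLHS]add0r lerD // ler_wpM2l.
  - by rewrite mulrDr mulr1 -[leLHS]addr0 lerD ?mulr_ge0 // ler1n.
have ex : exists m, 2 ^- m <= gap / 2.
  exists (Num.bound (2 / gap)).
  have b0 : 0 < 2 / gap by rewrite divr_gt0.
  have h : 2 / gap <= 2 ^+ Num.bound (2 / gap).
    apply: le_trans (ltW (archi_boundP (ltW b0))) _.
    by rewrite -natrX ler_nat ltnW // ltn_expl.
  rewrite -[leRHS]invrK lef_pV2 ?posrE ?exprn_gt0 ?invr_gt0 ?divr_gt0 //.
  by rewrite invf_div.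
have [m mg mmin] := ex_minnP ex.
have m0 : (0 < m)%N.
  case: m mg {mmin} => // h; exfalso; move: h; rewrite expr0 invr1; lra.
have pg : 2 ^+ m <= 4 / gap.
  have : ~~ (2 ^- m.-1 <= gap / 2).
    by apply/negP => /mmin; rewrite leqNgt ltn_predL m0.
  rewrite -ltNge ltr_pdivrMr // => h.
  rewrite -(prednK m0) exprS ler_pdivlMr //.
  move: h; rewrite ltr_pdivlMl ?exprn_gt0 //; move: (2 ^+ m.-1) => x; lra.
exists m; split => //.
- rewrite ler_pdivlMr // -exprMn.
  have : 2 ^+ m * gap <= 4 by rewrite -ler_pdivlMr.
  move=> h; have : (2 ^+ m * gap) ^+ 2 <= 4 ^+ 2.
    by rewrite ler_pXn2r // nnegrE ?mulr_ge0 ?exprn_ge0 ?(ltW g0).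
  move=> /le_trans; apply; rewrite -natrX lerDl mulr_ge0 ?sqr_ge0 //.
- have : ln (2 ^+ m) <= ln (4 / gap) by rewrite ler_ln ?posrE ?exprn_gt0 ?divr_gt0.
  have e4 : ln 4 = 2 * ln 2 :> R by rewrite -[4]/((2 * 2)%:R) natrM lnM ?posrE //; ring.
  rewrite lnXn // lnM ?posrE ?invr_gt0 // e4 -[ln 2 *+ m]mulr_natr => h.
  have : ln gap^-1 <= ln (1 + gap^-1).
    by rewrite ler_ln ?posrE ?invr_gt0 // ?lerDr // ltr_wpDl // invr_gt0.
  have := ln2_ge_half; have : 0 <= m%:R :> R by [].
  move: h lg; move: (m%:R : R) (ln 2 : R) (ln gap^-1) (ln (1 + gap^-1)) => x l a b.
  move=> h b0 x0 l2 ab.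
  (* The bound is (m - 2) ln 2 <= ln (1/gap); replacing ln 2 by 1/2 requires m > 2. *)
  have [h2|h2] := leP x 2; first by lra.
  have : 2^-1 * (x - 2) <= l * (x - 2) by rewrite ler_wpM2r //; lra.
  by lra.
Qed.

End Rounds.

Section MinGap.
Context {R : realType} {V n : nat}.
Variables (F : arm V n -> R) (best : 'I_V -> 'I_n).
Hypotheses (V0 : (0 < V)%N) (n1 : (1 < n)%N).
Hypothesis best_lt : forall v i, i != best v -> F (v, i) < F (v, best v).

Lemma exists_suboptimal v : exists i, i != best v.
Proof.
have [e|ne] := eqVneq (best v) (Ordinal (ltnW n1)).
  by exists (Ordinal n1); rewrite e.
by exists (Ordinal (ltnW n1)); rewrite eq_sym.
Qed.

Lemma min_gap_le v i : i != best v -> min_gap F best <= F (v, best v) - F (v, i).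
Proof.
move=> ib; apply: ge_inf; last by exists v, i.
by exists 0 => _ [u [k [kb ->]]]; rewrite subr_ge0 ltW // best_lt.
Qed.

Lemma min_gap_gt0 : 0 < min_gap F best.
Proof.
pose v0 := Ordinal V0; have [i0 i0b] := exists_suboptimal v0.
pose f (p : 'I_V * 'I_n) := F (p.1, best p.1) - F p.
have P0 : (fun p : 'I_V * 'I_n => p.2 != best p.1) (v0, i0) by [].
have [/= [v i] vi pmin] := @arg_minP _ _ _ (v0, i0) (fun p => p.2 != best p.1) f P0.
apply: (@lt_le_trans _ _ (f (v, i))); first by rewrite subr_gt0 best_lt.
apply: lb_le_inf; first by exists (f (v0, i0)), v0, i0.
by move=> _ [u [k [kb ->]]]; exact: (pmin (u, k)).
Qed.

End MinGap.

(** * Budgets in terms of the information gain, and the three bounds *)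

Section Main.
Context {R : realType} {H : lmodType R} {V n : nat}.
Context {d : measure_display} {Om : measurableType d}.
Variable P : probability Om R.
Variables (dot : {dot H for idfun}) (feat : arm V n -> H) (theta : H).
Variable best : 'I_V -> 'I_n.
Variable eta : nat * arm V n * nat -> {RV P >-> R}.
Variables (delta xi : R) (lam : arm_sets V n -> {ffun arm V n -> R}).
Variable tau : R -> {ffun arm V n -> R} -> R -> nat.
Variable ROUND : R -> {ffun arm V n -> R} -> forall N : nat, R -> N.-tuple (arm V n).
Variables (lstar : {ffun arm V n -> R}) (alpha : seq R) (Ctau gap_bound : R).

Local Notation eps := (10^-1).
Local Notation F := (fun a => dot (feat a) theta).
Local Notation full := (all_arms V n).
Local Notation gap := (min_gap F best).
Local Notation budget := (budget dot feat xi delta eps lam tau).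
Local Notation rho := (rho dot feat xi lam).
Local Notation gram := (gram dot feat).
Local Notation Y := (info_gain gram xi lstar).
Local Notation L := (log_factor V n xi delta gap (\tr (weighted_gram gram lstar))).
Local Notation candidates := (candidates dot feat gram F
  (fun r a j => eta (r, a, j)) xi delta eps lam tau ROUND).
Local Notation calm := (calm dot feat eta delta xi lam tau ROUND).
Local Notation sample_complexity := (sample_complexity dot feat gram F
  (fun r a j => eta (r, a, j)) xi delta eps lam tau ROUND).

Hypotheses (V0 : (0 < V)%N) (n1 : (1 < n)%N).
Hypothesis best_lt : forall v i, i != best v -> F (v, i) < F (v, best v).
Hypothesis gap_le : gap <= gap_bound.
Hypothesis indep : mutually_independent eta.
Hypothesis sg : forall t, one_subgaussian (eta t).
Hypotheses (delta01 : 0 < delta < 1) (xi0 : 0 < xi).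
Hypothesis lam_opt : forall B, optimal_design dot feat xi B (lam B).
Hypothesis tau_le : forall l, simplex l ->
  (tau xi l eps)%:R <= Ctau * (dtilde dot feat xi l)%:R / eps ^+ 2.
Hypothesis ROUND_spec : forall B N, (tau xi (lam B) eps <= N)%N ->
  round_guarantee dot feat xi eps B (lam B) (ROUND xi (lam B) N eps).
Hypotheses (sl : simplex lstar)
  (lmax : forall l', simplex l' -> info_gain gram xi l' <= info_gain gram xi lstar)
  (Ka : is_spectrum (weighted_gram gram lstar) alpha).
Hypothesis xi_le : Num.sqrt xi * width dot feat full (reg_op dot feat xi (lam full))
  <= gap / (32 * (1 + eps) * Num.sqrt (dot theta theta)).

Let gap0 : 0 < gap. Proof. exact: min_gap_gt0. Qed.

Let W := width dot feat full (reg_op dot feat xi (lam full)).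

Lemma width_ub v i j :
  inv_norm dot (reg_op dot feat xi (lam full)) (feat (v, i) - feat (v, j)) <= W.
Proof.
apply: (max_pairs_ub (fun a b => inv_norm dot (reg_op dot feat xi (lam full)) (feat a - feat b))).
  by rewrite ffunE inE.
by rewrite ffunE inE.
Qed.

Lemma theta_gt0 : 0 < dot theta theta.
Proof.
rewrite lt_def dot_ge0 andbT dot_eq0; apply/eqP => t0.
have [i ib] := exists_suboptimal best n1 (Ordinal V0).
by have := best_lt ib; rewrite t0 !dot0r ltxx.
Qed.

(** 32 (1 + eps) = 35.2 is lowered to 30, which suffices for a bias of gap / 20 since 2.2 * 20^2 =
    880 <= 30^2. *)
Lemma xi_width_theta : (30 * (Num.sqrt xi * W * Num.sqrt (dot theta theta))) ^+ 2 <= gap ^+ 2.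
Proof.
have s0 : 0 < Num.sqrt (dot theta theta) by rewrite sqrtr_gt0 theta_gt0.
have W0 : 0 <= W by exact: max_pairs_ge0.
have u0 : 0 <= Num.sqrt xi * W * Num.sqrt (dot theta theta).
  by rewrite !mulr_ge0 ?sqrtr_ge0.
have : Num.sqrt xi * W * Num.sqrt (dot theta theta) * (32 * (1 + eps)) <= gap.
  rewrite -mulrA [Num.sqrt (dot _ _) * _]mulrC -ler_pdivlMr //.
  by rewrite !mulr_gt0 // addr_gt0 // invr_gt0.
move: (Num.sqrt xi * W * _) u0 gap gap0 => u u0 g g0 h.
rewrite ler_pXn2r ?nnegrE ?(ltW g0) ?mulr_ge0 //; apply: le_trans h.
rewrite mulrC ler_wpM2l //; lra.
Qed.

Lemma sqr_xi_width : (Num.sqrt xi * W * Num.sqrt (dot theta theta)) ^+ 2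
  = xi * W ^+ 2 * dot theta theta.
Proof. by rewrite !exprMn !sqr_sqrtr // ?dot_ge0 // ltW. Qed.

Lemma xi_rho_small : 22 / 10 * xi * rho full * dot theta theta <= (gap / 20) ^+ 2.
Proof.
have rW : rho full <= W ^+ 2.
  apply: max_pairs_le => [|v i j _ _]; first exact: sqr_ge0.
  rewrite ler_pXn2r ?width_ub // ?nnegrE ?sqrtr_ge0 //; exact: max_pairs_ge0.
apply: (@le_trans _ _ (22 / 10 * (xi * W ^+ 2 * dot theta theta))).
  rewrite -[leLHS]mulrA -[leLHS]mulrA ler_wpM2l ?divr_ge0 // -mulrA.
  by rewrite ler_wpM2l ?(ltW xi0) // ler_wpM2r ?dot_ge0.
rewrite -sqr_xi_width; have := xi_width_theta; move: (Num.sqrt xi * W * _) gap => u g.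
rewrite !exprMn; have : 0 <= u ^+ 2 by exact: sqr_ge0.
move: (u ^+ 2) (g ^+ 2) => x y x0 h; rewrite !exprVn !expr2 in h *.
have -> : (20 * 20)^-1 = 20^-1 * 20^-1 :> R by rewrite invfM.
lra.
Qed.

(** Let y separate a best arm from a suboptimal one: gap <= |y| |theta|, and with [xi_width_theta]
    this bounds |y|^2 below by 900 xi times its [invq], far above the factor 2 required by
    [info_gain_ge_half]. *)
Lemma info_gain_lstar_ge_half : 2^-1 <= Y.
Proof.
have [i ib] := exists_suboptimal best n1 (Ordinal V0); set v := Ordinal V0 in ib.
apply: le_trans (lmax (proj1 (lam_opt full))).
pose y := feat (v, best v) - feat (v, i).
have l0 a : 0 <= lam full a by case: (lam_opt full) => -[].
have gy : gap <= dot y theta by rewrite dotBl; exact: min_gap_le.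
have yy : 0 < dot y y.
  rewrite lt_def dot_ge0 andbT dot_eq0; apply/eqP => y0.
  by have := lt_le_trans gap0 gy; rewrite y0 dotC dot0r ltxx.
apply: (info_gain_ge_half xi0 l0 yy).
have qW : invq dot feat xi (lam full) y <= W ^+ 2.
  rewrite -(sqr_inv_norm dot feat xi0 l0) ler_pXn2r ?nnegrE ?sqrtr_ge0 ?width_ub //.
  exact: max_pairs_ge0.
have := xi_width_theta; rewrite exprMn sqr_xi_width.
have : gap ^+ 2 <= dot y y * dot theta theta.
  apply: le_trans (dot_CauchySchwarz dot y theta).
  by rewrite ler_pXn2r ?nnegrE ?(ltW gap0) // (le_trans (ltW gap0)).
move=> h1 /le_trans /(_ h1); rewrite mulrA ler_pM2r ?theta_gt0 // => h2.
apply: le_trans h2; rewrite -mulrA.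
apply: (@le_trans _ _ (2 * (xi * W ^+ 2))).
  by rewrite ler_wpM2l // ler_wpM2l ?(ltW xi0).
have : 0 <= xi * W ^+ 2 by rewrite mulr_ge0 ?sqr_ge0 ?(ltW xi0).
move: (xi * W ^+ 2) => x x0; rewrite expr2; lra.
Qed.

Lemma log_terms_ge0 : [/\ 0 <= ln n%:R :> R, 0 <= ln V%:R :> R, 0 <= ln delta^-1,
  0 <= ln (1 + gap^-1) & 0 <= ln (1 + \tr (weighted_gram gram lstar) / xi)].
Proof.
case/andP: delta01 => d0 d1; split; rewrite ?ln_nat_ge0 //.
- by rewrite ln_ge0 // invf_ge1 // ltW.
- by rewrite ln_ge0 // lerDl invr_ge0 ltW.
- by apply: ln_trace_ge0 => //; case: sl.
Qed.

Lemma log_factor_ge : [/\ 1 <= L, 1 + ln (1 + gap^-1) <= L &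
  ln (1 + \tr (weighted_gram gram lstar) / xi) + (ln n%:R + ln V%:R) <= L].
Proof.
rewrite /log_factor; case: log_terms_ge0.
move: (ln n%:R) (ln V%:R) (ln delta^-1) (ln (1 + gap^-1)) (ln (1 + _ / xi)).
by move=> x1 x2 x3 x4 x5; split; lra.
Qed.

Lemma dtilde_le l : simplex l -> (dtilde dot feat xi l)%:R <= 2 * Y.
Proof.
move=> s; have := le_trans (dtilde_info_gain dot feat xi0 (proj1 s)) (lmax s).
have := @ln2_ge_half R; have : 0 <= (dtilde dot feat xi l)%:R :> R by [].
move: (dtilde dot feat xi l)%:R (ln 2) Y => x l2 z x0 h2 h.
have : x * 2^-1 <= x * l2 by rewrite ler_wpM2l.
lra.
Qed.

(** The round index enters through [delta_]; crudely 2 ln r <= 2 m <= 8 L, the remaining terms add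
    up to at most 2 L, and 13 leaves slack. *)
Lemma log_term_le m r : (0 < r <= m)%N -> m%:R <= 4 * L ->
  @log_term R V n delta r <= 13 * L.
Proof.
case/andP: delta01 => d0 d1 /andP [r0 rm] mL.
have rp : 0 < r%:R :> R by rewrite ltr0n.
have np : 0 < n%:R :> R by rewrite ltr0n ltnW.
have vp : 0 < V%:R :> R by rewrite ltr0n.
have -> : @log_term R V n delta r
    = 2 * ln 2 + 2 * ln n%:R + ln V%:R + 2 * ln r%:R + ln delta^-1.
  have -> : @log_term R V n delta r
      = ln (2 ^+ 2 * n%:R ^+ 2 * V%:R * r%:R ^+ 2 * delta^-1).
    congr ln; rewrite /delta_; field; by rewrite !gt_eqF.
  have lnM5 (a b c e f : R) : 0 < a -> 0 < b -> 0 < c -> 0 < e -> 0 < f ->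
      ln (a * b * c * e * f) = ln a + ln b + ln c + ln e + ln f.
    by move=> a0 b0 c0 e0 f0; rewrite !lnM ?posrE ?mulr_gt0.
  by rewrite lnM5 ?exprn_gt0 ?invr_gt0 // !lnXn // !mulr2n; ring.
have l2 : ln 2 <= 1 :> R.
  by have : ln (1 + 1) <= 1 :> R by apply: le_ln1Dx; lra.
have lr : ln r%:R <= m%:R :> R.
  apply: (@le_trans _ _ r%:R); last by rewrite ler_nat.
  apply: (@le_trans _ _ (ln (1 + r%:R))); last by apply: le_ln1Dx; apply: lt_trans rp; lra.
  by rewrite ler_ln ?posrE ?addr_gt0 // lerDr.
move: mL l2 lr; rewrite /log_factor; case: log_terms_ge0.
move: (ln 2) (ln n%:R) (ln V%:R) (ln r%:R) (ln delta^-1) (ln (1 + gap^-1)).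
move: (ln (1 + _ / xi)) (m%:R : R).
by move=> x1 x2 x3 x4 x5 x6 x7 x8; lra.
Qed.

Let M := 16 + 4 * gap_bound ^+ 2.

(** 4 and 13 come from rho <= 4 Y and [log_term_le]; the summand 2 absorbs the ceiling through 1 <=
    2 Y; the last one is the rounding cost through dtilde <= 2 Y, with an absolute value as [Ctau]
    has no prescribed sign. [M] bounds 4^r gap^2. *)
Definition budget_const := (32 * (1 + eps) ^+ 2 * (4 * 13) + 2 + 2 * (`|Ctau| / eps ^+ 2)) * M.

Lemma budget_const_ge0 : 0 <= budget_const.
Proof.
by rewrite /budget_const mulr_ge0 // addr_ge0 // mulr_ge0 // sqr_ge0.
Qed.

Lemma budget_ub m r B : (0 < r <= m)%N -> m%:R <= 4 * L ->
  (2 ^+ m) ^+ 2 <= M / gap ^+ 2 ->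
  (budget r B)%:R <= budget_const * (L * Y / gap ^+ 2).
Proof.
move=> rm mL mM; have r0 : (0 < r)%N by case/andP: rm.
apply: le_trans (budget_le dot feat xi lam tau V0 n1 delta01 B r0) _.
have [L1 _ _] := log_factor_ge; have Y2 := info_gain_lstar_ge_half.
have g2 : 0 < gap ^+ 2 by rewrite exprn_gt0.
(* Allows the terms without a factor 4^r to be inflated to the common shape. *)
have Mg : 1 <= M / gap ^+ 2.
  rewrite ler_pdivlMr // mul1r /M.
  have : gap ^+ 2 <= gap_bound ^+ 2.
    by rewrite ler_pXn2r ?nnegrE ?(ltW gap0) // (le_trans (ltW gap0)).
  have := sqr_ge0 gap_bound; move: (gap ^+ 2) (gap_bound ^+ 2) => x y; lra.
have lt := log_term_le rm mL.
have ltp : 0 < @log_term R V n delta r by exact: log_term_gt0.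
have rho4 : rho B <= 4 * Y.
  apply: le_trans (sq_width_le_info_gain xi0 sl lmax Ka B).
  by case: (lam_opt B) => _ /(_ _ sl).
have p2 : (2 ^+ r) ^+ 2 <= M / gap ^+ 2.
  apply: le_trans mM; rewrite ler_pXn2r ?nnegrE ?exprn_ge0 //.
  by rewrite ler_weXn2l ?ler1n //; case/andP: rm.
have tl : (tau xi (lam B) eps)%:R <= 2 * (`|Ctau| / eps ^+ 2) * Y.
  apply: le_trans (tau_le (proj1 (lam_opt B))) _.
  apply: (@le_trans _ _ (`|Ctau| * (2 * Y) / eps ^+ 2)).
    rewrite ler_wpM2r ?invr_ge0 ?sqr_ge0 //.
    apply: le_trans (ler_wpM2r _ (ler_norm _)) _; first by [].
    by rewrite ler_wpM2l // dtilde_le //; case: (lam_opt B).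
  by rewrite le_eqVlt; apply/orP; left; apply/eqP; ring.
have Y0 : 0 <= Y by apply: le_trans Y2; rewrite invr_ge0.
have L0 : 0 <= L by exact: le_trans L1.
have Mg0 : 0 <= M / gap ^+ 2 by exact: le_trans Mg.
have e0 : 0 <= 32 * (1 + eps) ^+ 2 :> R by rewrite mulr_ge0 ?sqr_ge0.
set c := M / gap ^+ 2 in Mg p2 Mg0.
have YcL : Y <= c * (L * Y).
  by rewrite mulrA -[leLHS]mul1r ler_wpM2r // mulr_ege1.
have -> : budget_const * (L * Y / gap ^+ 2) =
   32 * (1 + eps) ^+ 2 * (c * (4 * Y) * (13 * L)) + 2 * (c * (L * Y))
   + 2 * (`|Ctau| / eps ^+ 2) * (c * (L * Y)).
  by rewrite /budget_const /c; ring.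
rewrite !lerD //.
- have -> : 32 * (2 ^+ r) ^+ 2 * (1 + eps) ^+ 2 * rho B * @log_term R V n delta r
    = 32 * (1 + eps) ^+ 2 * ((2 ^+ r) ^+ 2 * rho B * @log_term R V n delta r) by ring.
  rewrite ler_wpM2l // ler_pM ?(ltW ltp) //.
    by rewrite mulr_ge0 ?sqr_ge0 ?rho_ge0.
  by rewrite ler_pM ?sqr_ge0 ?rho_ge0.
- apply: (@le_trans _ _ (2 * Y)); last by rewrite ler_wpM2l.
  by move: (Y) Y2 => z; lra.
- apply: le_trans tl _; rewrite ler_wpM2l // mulr_ge0 // divr_ge0 // sqr_ge0.
Qed.

(** One power of L comes from the confidence term of a round, the other from the number of
    rounds. *)
Lemma sample_complexity_ub :
  ((1 - delta)%:E <= P [set w | (sample_complexity w <=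
     (4 * budget_const * (L ^+ 2 * Y / (gap ^+ 2 * V%:R)))%:E)%E])%E.
Proof.
have [m [m0 mg mM mL]] := exists_round_bound gap0 gap_le.
have [L1 gapL _] := log_factor_ge.
have {}mL : m%:R <= 4 * L by apply: le_trans mL _; rewrite ler_wpM2l.
have [mcalm pcalm] := calm_probability theta xi0 V0 n1 delta01 lam_opt ROUND_spec indep sg m.
apply: le_trans pcalm _; apply: le_measure; rewrite ?inE //.
  exact: sample_complexity_measurable.
move=> w cw /=.
have K0 : 0 <= budget_const * (L * Y / gap ^+ 2).
  rewrite mulr_ge0 ?budget_const_ge0 // divr_ge0 ?sqr_ge0 // mulr_ge0 //.
    exact: le_trans L1.
  by apply: le_trans info_gain_lstar_ge_half; rewrite invr_ge0.
apply: le_trans (sample_complexity_le xi0 V0 n1 delta01 lam_opt ROUND_spec gap0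
  xi_rho_small (min_gap_le best_lt) m0 mg K0 cw _) _.
  by move=> r B rm; apply: budget_ub rm mL mM.
rewrite lee_fin.
have -> : 4 * budget_const * (L ^+ 2 * Y / (gap ^+ 2 * V%:R))
    = 4 * L * (budget_const * (L * Y / gap ^+ 2)) / V%:R.
  by rewrite invfM; ring.
by rewrite ler_wpM2r ?invr_ge0 // ler_wpM2r.
Qed.

(** The weights are attached to the arm factor. The task factor is lifted from agents to arms as S K
    S^T, with S the incidence matrix of arms and agents, which does not raise the rank. *)
Lemma rank_weighted_gram_le (g : 'I_V -> 'I_V -> R) (h : arm V n -> arm V n -> R) :
  (forall a b, gram a b = g a.1 b.1 * h a b) ->
  (\rank (weighted_gram gram lstar) <=
   \rank (\matrix_(v, v') g v v') * \rank (weighted_gram h lstar))%N.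
Proof.
move=> gE; pose G : 'M[R]_#|{: arm V n}| := \matrix_(i, j) g (enum_val i).1 (enum_val j).1.
have -> : weighted_gram gram lstar = \matrix_(i, j) (G i j * weighted_gram h lstar i j).
  by apply/matrixP => i j; rewrite !mxE gE mulrCA.
apply: leq_trans (mxrank_hadamard _ _) _; rewrite leq_mul2r; apply/orP; right.
pose S : 'M[R]_(#|{: arm V n}|, V) := \matrix_(i, v) ((enum_val i).1 == v)%:R.
have -> : G = S *m (\matrix_(v, v') g v v') *m S^T.
  apply/matrixP => i j; rewrite !mxE (bigD1 (enum_val j).1) //= big1 ?addr0 => [|v vj].
    rewrite !mxE eqxx mulr1 (bigD1 (enum_val i).1) //= big1 ?addr0 => [|v vi].
      by rewrite !mxE eqxx mul1r.
    by rewrite !mxE eq_sym (negPf vi) mul0r.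
  by rewrite !mxE eq_sym (negPf vj) mulr0.
exact: leq_trans (mxrankM_maxl _ _) (mxrankM_maxr _ _).
Qed.

(** Each of the three quantities X satisfies Y <= X L, the source of the third power of L. The same
    event serves all three bounds. *)
Lemma main_bound (g : 'I_V -> 'I_V -> R) (h : arm V n -> arm V n -> R) (C c : R) :
  (forall a b, gram a b = g a.1 b.1 * h a b) ->
  C = 4 * budget_const -> 0 <= c ->
  ((1 - delta)%:E <= P [set w |
   [/\ (sample_complexity w <=
         (C * (L ^+ 3 * (max_info_gain gram xi / (gap ^+ 2 * V%:R)) + c))%:E)%E,
      (sample_complexity w <=
         (C * (L ^+ 3 * ((effective_dim V n xi alpha)%:R / (gap ^+ 2 * V%:R)) + c))%:E)%E &
      (sample_complexity w <=
         (C * (L ^+ 3 * ((\rank (\matrix_(v, v') g v v') * \rank (weighted_gram h lstar))%:R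
            / (gap ^+ 2 * V%:R)) + c))%:E)%E]])%E.
Proof.
move=> gE -> c0; apply: le_trans sample_complexity_ub _.
have [L1 _ sumL] := log_factor_ge; have L0 : 0 <= L by exact: le_trans L1.
have boundX X : Y <= X * L ->
    4 * budget_const * (L ^+ 2 * Y / (gap ^+ 2 * V%:R)) <=
    4 * budget_const * (L ^+ 3 * (X / (gap ^+ 2 * V%:R)) + c).
  have C0 : 0 <= 4 * budget_const by apply: mulr_ge0 => //; exact: budget_const_ge0.
  move=> YX; rewrite ler_wpM2l // -[leLHS]addr0 lerD //.
  have gV : 0 <= gap ^+ 2 * V%:R by apply: mulr_ge0 => //; exact: sqr_ge0.
  rewrite [leRHS]mulrA ler_wpM2r ?invr_ge0 //.
  by rewrite [_ ^+ 3]exprSr -mulrA ler_wpM2l ?exprn_ge0 // mulrC.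
have ms (x : R) : measurable [set w | (sample_complexity w <= x%:E)%E].
  exact: sample_complexity_measurable.
have Y0 : 0 <= Y by apply: le_trans info_gain_lstar_ge_half; rewrite invr_ge0.
have [ln0n ln0v _ _ _] := log_terms_ge0.
apply: le_measure; rewrite ?inE.
- exact: ms.
- have m3 (A1 A2 A3 : set Om) : measurable A1 -> measurable A2 -> measurable A3 ->
      measurable [set w | [/\ A1 w, A2 w & A3 w]].
    move=> m1 m2 m3; rewrite (_ : [set w | _] = A1 `&` A2 `&` A3).
      by apply: measurableI => //; exact: measurableI.
    by apply/seteqP; split => w /=; [case|case=> -[]].
  by apply: m3; exact: ms.
move=> w /= Sw; split; apply: le_trans Sw _; rewrite lee_fin; apply: boundX.
- by rewrite (max_info_gainE sl lmax) -[leLHS]mulr1 ler_wpM2l.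
- apply: le_trans (info_gain_le_effective_dim xi0 sl Ka) _; rewrite ler_wpM2l //.
  by rewrite natrM lnM ?posrE ?ltr0n ?(ltnW n1).
- apply: le_trans (info_gain_le_rank xi0 sl Ka) _; apply: ler_pM => //.
  + by case: log_terms_ge0.
  + by rewrite ler_nat rank_weighted_gram_le.
  + by apply: le_trans sumL; rewrite lerDl addr_ge0.
Qed.

End Main.

Theorem corollary1 (R : realType) (Ctau gap_bound : R) :
  exists (C : R) (q : nat),
  forall (V n p : nat) (Z : Type) (z : 'I_V -> Z)
    (x : 'I_V -> 'I_n -> 'rV[R]_p)
    (kZ : Z -> Z -> R) (kX : 'rV[R]_p -> 'rV[R]_p -> R)
    (H : completeNormedModType R) (dot : {dot H for idfun})
    (ev : H -> Z * 'rV[R]_p -> R) (phi : Z * 'rV[R]_p -> H) (theta : H)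
    (best : 'I_V -> 'I_n)
    (d : measure_display) (Om : measurableType d) (P : probability Om R)
    (eta : nat * arm V n * nat -> {RV P >-> R})
    (delta xi : R)
    (lam : arm_sets V n -> {ffun arm V n -> R})
    (tau : R -> {ffun arm V n -> R} -> R -> nat)
    (ROUND : R -> {ffun arm V n -> R} ->
             forall N : nat, R -> N.-tuple (arm V n))
    (lstar : {ffun arm V n -> R}) (alpha : seq R),
  let eps : R := 10^-1 in
  let pair (a : arm V n) := (z a.1, x a.1 a.2) in
  let D := [set t : Z * 'rV[R]_p | exists v i, t.2 = x v i] in
  let k := product_kernel kZ kX in
  let feat a := phi (pair a) in
  let kA a b := k (pair a) (pair b) in
  let F a := dot (feat a) theta in
  let gap := min_gap F best in
  let full := all_arms V n in
  let S := sample_complexity dot feat kA F (fun r a j => eta (r, a, j))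
             xi delta eps lam tau ROUND in
  let L := log_factor V n xi delta gap
             (\tr (weighted_gram kA lstar)) in
  let rounding :=
    (dtilde dot feat xi (lam full))%:R * Num.max 0 (ln gap^-1) / V%:R in
  let bound (X : R) := C * (L ^+ q * (X / (gap ^+ 2 * V%:R)) + rounding) in
  (0 < V)%N -> (1 < n)%N ->
  (forall h : H, `|h| = Num.sqrt (dot h h)) ->
  is_rkhs D k dot ev ->
  (forall s t, D s -> D t -> k s t = dot (phi s) (phi t)) ->
  (forall v i, i != best v -> F (v, i) < F (v, best v)) ->
  gap <= gap_bound ->
  mutually_independent eta ->
  (forall j, ('E_P[eta j] = 0)%E) ->
  (forall j, one_subgaussian (eta j)) ->
  0 < delta < 1 -> 0 < xi ->
  (forall B, optimal_design dot feat xi B (lam B)) ->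
  (forall l, simplex l ->
     (tau xi l eps)%:R <= Ctau * (dtilde dot feat xi l)%:R / eps ^+ 2) ->
  (forall l N, simplex l -> (tau xi l eps <= N)%N ->
     round_guarantee dot feat xi eps full l (ROUND xi l N eps)) ->
  (forall B N, (tau xi (lam B) eps <= N)%N ->
     round_guarantee dot feat xi eps B (lam B) (ROUND xi (lam B) N eps)) ->
  simplex lstar ->
  (forall l, simplex l -> info_gain kA xi l <= info_gain kA xi lstar) ->
  is_spectrum (weighted_gram kA lstar) alpha ->
  Num.sqrt xi * width dot feat full (reg_op dot feat xi (lam full))
    <= gap / (32 * (1 + eps) * `|theta|) ->
  ((1 - delta)%:E <=
   P [set w | [/\ (S w <= (bound (max_info_gain kA xi))%:E)%E,
       (S w <= (bound (effective_dim V n xi alpha)%:R)%:E)%E &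
       (S w <= (bound (\rank (\matrix_(v, v') kZ (z v) (z v'))
                 * \rank (weighted_gram (fun a b => kX (x a.1 a.2) (x b.1 b.2))
                            lstar))%:R)%:E)%E]])%E.
Proof.
exists (4 * budget_const Ctau gap_bound), 3%N.
move=> V n p Z z x kZ kX H dot ev phi theta best d Om P eta delta xi lam tau ROUND.
move=> lstar alpha eps pair D k feat kA F gap full S L rounding bound.
move=> V0 n1 normE _ kphi best_lt gap_le indep _ sg delta01 xi0 lam_opt tau_le _.
move=> ROUND_spec sl lmax Ka xi_le.
have kAE : kA = gram dot feat.
  apply/funext => a; apply/funext => b; apply: kphi.
    by exists a.1, a.2.
  by exists b.1, b.2.
have gE a b : gram dot feat a b = kZ (z a.1) (z b.1) * kX (x a.1 a.2) (x b.1 b.2).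
  by rewrite -kAE.
have c0 : 0 <= rounding.
  by rewrite /rounding divr_ge0 // mulr_ge0 // le_max lexx.
rewrite normE in xi_le.
move: lmax Ka; rewrite /bound /S /L kAE => lmax Ka.
exact: (main_bound V0 n1 best_lt gap_le indep sg delta01 xi0 lam_opt tau_le
  ROUND_spec sl lmax Ka xi_le gE (erefl _) c0).
Qed.
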